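(* Let $n \geq 2$ and let $z_1,\dots,z_n$ be the standard coordinates on $\mathbb{C}^n$. Consider the complete polynomial vector fields $$U = \frac{\partial}{\partial z_n},$$ $$V = \frac{\partial}{\partial z_n} + \sum_{k=2}^{n} \Big(\prod_{j=k+1}^{n} z_j\Big) z_k^3 \,\frac{\partial}{\partial z_{k-1}} = \frac{\partial}{\partial z_n} + z_n^3 \frac{\partial}{\partial z_{n-1}} + z_n z_{n-1}^3 \frac{\partial}{\partial z_{n-2}} + \dots + z_n z_{n-1}\cdots z_3 z_2^3 \frac{\partial}{\partial z_1},$$ $$W = z_1^2 \cdots z_{n-1}^2 \cdot z_n \frac{\partial}{\partial z_n}.$$ Then the group of holomorphic automorphisms of $\mathbb{C}^n$ generated by the flows of $U$, $V$ and $W$ acts infinitely transitively on $\mathbb{C}^n$.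
   Context: A holomorphic vector field is called complete if its flow map exists for all complex times; the group generated by the flows is the group generated by all time-$t$ maps, $t \in \mathbb{C}$, of the flows of the given vector fields. An action of a group $G$ on a complex manifold $X$ is infinitely transitive if it is $m$-transitive for every $m \in \mathbb{N}$, i.e. for any two $m$-tuples $(x_1,\dots,x_m)$ and $(y_1,\dots,y_m)$ of pairwise distinct points of $X$ there is $g \in G$ with $g x_i = y_i$ for all $i = 1,\dots,m$. Empty products equal $1$. *)

(* Defs.v *)
From mathcomp Require Import all_boot all_order all_algebra.
From mathcomp Require Import all_classical all_reals all_analysis.

Set Implicit Arguments.
Unset Strict Implicit.
Unset Printing Implicit Defensive.

Import Order.TTheory GRing.Theory Num.Theory.
Import numFieldNormedType.Exports.

Local Open Scope classical_set_scope.
Local Open Scope ring_scope.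

(* The scalar field K is meant to be the field R[i] of complex numbers; it is
   kept abstract here only because the topology and norm of a numFieldType
   are inferred automatically for an abstract K. *)
Section Flows.
Context (K : numFieldType) (n : nat).

(* Differentiability is over K: for K = R[i] this is complex (Frechet)
   differentiability at every point of C^n. *)
Definition holomorphic (f : 'rV[K]_n -> 'rV[K]_n) : Prop :=
  forall z, differentiable f z.

Definition hol_aut : set ('rV[K]_n -> 'rV[K]_n) :=
  [set f | holomorphic f /\
           exists g, [/\ holomorphic g, cancel f g & cancel g f]].

(* Time ranges over K, and the derivative in t is the K-derivative. *)
Definition is_flow (X : 'rV[K]_n -> 'rV[K]_n) (phi : K -> 'rV[K]_n -> 'rV[K]_n) :
    Prop :=
  forall z, phi 0 z = z /\
    forall t : K, is_derive t 1 (fun s => phi s z) (X (phi t z)).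

Definition complete (X : 'rV[K]_n -> 'rV[K]_n) : Prop :=
  exists phi, is_flow X phi.

Definition map_group (G : set ('rV[K]_n -> 'rV[K]_n)) : Prop :=
  [/\ G id,
      forall f g, G f -> G g -> G (f \o g) &
      forall f g, G f -> cancel f g -> cancel g f -> G g].

Definition time_maps (F : set ('rV[K]_n -> 'rV[K]_n)) :
    set ('rV[K]_n -> 'rV[K]_n) :=
  [set f | exists X phi t, [/\ F X, is_flow X phi & f = phi t]].

Definition flow_group (F : set ('rV[K]_n -> 'rV[K]_n)) :
    set ('rV[K]_n -> 'rV[K]_n) :=
  smallest map_group (time_maps F).

Definition infinitely_transitive (G : set ('rV[K]_n -> 'rV[K]_n)) : Prop :=
  forall (m : nat) (x y : 'I_m -> 'rV[K]_n), injective x -> injective y ->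
    exists2 g, G g & forall i, g (x i) = y i.

End Flows.

(* In dimension n.+1 the coordinates z_1, ..., z_{n+1} are the entries
   z 0 0, ..., z 0 ord_max, and d/dz_k is the constant row vector 'e_(k-1). *)
Section Fields.
Context (K : numFieldType) (n : nat).

Definition fieldU (z : 'rV[K]_n.+1) : 'rV[K]_n.+1 := 'e_ord_max.

Definition fieldV (z : 'rV[K]_n.+1) : 'rV[K]_n.+1 :=
  'e_ord_max +
  \sum_(k < n.+1 | (0 < k)%N)
    ((\prod_(j < n.+1 | (k < j)%N) z 0 j) * z 0 k ^+ 3) *: 'e_(inord k.-1).

Definition fieldW (z : 'rV[K]_n.+1) : 'rV[K]_n.+1 :=
  ((\prod_(j < n.+1 | (j < n)%N) z 0 j ^+ 2) * z 0 ord_max) *: 'e_ord_max.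

End Fields.

(* Main.v *)
(** In the coordinates x_r := z_(N-r), with N = n.+1, the flows of U and V are
    polynomial and triangular, and they are homogeneous for the weights [wt].
    Composition with a map lowering weights by i is 1 + A with A of weight -i,
    and the commutator of 1 + A and 1 + B is 1 + [A, B] up to lower order; so
    the group commutators which mimic the Lie brackets of d/dx_0 and V give
    triangular maps whose leading part is d/dx_r or x_r d/dx_(r+1), the error
    affecting only the coordinates of higher index, or adding to the latter
    shear a function of x_0, ..., x_(r-1). In this way the group contains, for
    all l < k, maps which fix x_s for s < k and send x_k to
    x_k + c x_l + rho(x_0, ..., x_(l-1)).

    The flows of U and W give the shears x_0 + a exp(c M), with
    M = (x_1 ... x_n)^2. Hence x_0 can be prescribed independently at finitely
    many points on which M is injective, after which a map with l = 0 prescribes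
    x_k at these points. Doing this for k = 1, ..., n connects any two tuples of
    points with nonzero x_1, ..., x_n and distinct M, and every tuple of
    distinct points is moved to such a tuple by generic powers of the maps
    above. *)

Require Import Defs.
From mathcomp Require Import all_boot all_order all_algebra complex.
From mathcomp Require Import all_classical all_reals all_analysis.
From mathcomp Require Import zify ring lra.

Set Implicit Arguments.
Unset Strict Implicit.
Unset Printing Implicit Defensive.

Import Order.TTheory GRing.Theory Num.Theory.
Import numFieldNormedType.Exports.

Local Open Scope classical_set_scope.
Local Open Scope ring_scope.

(** * Weighted degree *)

(** The first component is the weight of x_r, chosen so that V, whose component along x_(r+1) is x_0
    ... x_(r-1) x_r^3, is homogeneous of weight -1. The second is 1 plus the sum of the weights of
    x_0, ..., x_(r-1); it is the amount by which the field [leadV r] lowers weights. *)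
Fixpoint weights (r : nat) : nat * nat :=
  if r is r'.+1 then
    ((weights r').2 + 3 * (weights r').1, (weights r').2 + (weights r').1)%N
  else (1, 1)%N.

Definition wt r := (weights r).1.
Definition wo r := (weights r).2.

Lemma wtS r : wt r.+1 = (wo r + 3 * wt r)%N. Proof. by []. Qed.
Lemma woS r : wo r.+1 = (wo r + wt r)%N. Proof. by []. Qed.

Lemma wt_gt0 r : (0 < wt r)%N.
Proof. by elim: r => // r ih; rewrite wtS; lia. Qed.

Lemma wo_gt0 r : (0 < wo r)%N.
Proof. by elim: r => // r ih; rewrite woS; lia. Qed.

Lemma wt_ltS r : (wt r < wt r.+1)%N.
Proof. by rewrite wtS; have := wt_gt0 r; lia. Qed.

Lemma leq_wt r s : (r <= s)%N -> (wt r <= wt s)%N.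
Proof. by apply: (homo_leq leqnn leq_trans) => i; apply/ltnW/wt_ltS. Qed.

Lemma ltn_wt r s : (r < s)%N -> (wt r < wt s)%N.
Proof. by move=> rs; apply: leq_trans (wt_ltS r) (leq_wt rs). Qed.

Lemma wo_sum r s : (r <= s)%N ->
  wo s = (wo r + \sum_(r <= i < s) wt i)%N.
Proof.
elim: s => [|s ih]; first by rewrite leqn0 => /eqP->; rewrite big_geq ?addn0.
rewrite leq_eqVlt => /predU1P[->|rs]; first by rewrite big_geq ?addn0.
by rewrite big_nat_recr//= woS ih// addnA.
Qed.

Section WeightedDegree.
Context (K : numFieldType) (n : nat).
Local Notation Z := 'rV[K]_n.+1.

(* The coordinates are numbered from the last one: [crd r] is z_(N-r), where
   N = n.+1, so that each field of the theorem changes [crd r] at a speed which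
   depends on the [crd s] with [s < r] only (or on all of them, for W). *)
Definition crd (r : nat) (z : Z) : K := z 0 (inord (n - r)).

Lemma crd_inj (z z' : Z) :
  (forall r, (r <= n)%N -> crd r z = crd r z') -> z = z'.
Proof.
move=> zz'; apply/rowP => j; have := zz' (n - j)%N (leq_subr _ _).
by rewrite /crd subKn ?inord_val// -ltnS.
Qed.

(* The degree is an integer, so that an operator lowering it by more than [d]
   kills [wdeg d]: see [wdeg_neg]. *)
Inductive wdeg : int -> (Z -> K) -> Prop :=
| wdeg0 d : wdeg d (fun=> 0)
| wdegC d c : 0 <= d -> wdeg d (fun=> c)
| wdegX d r f : (r <= n)%N -> wdeg d f ->
    wdeg (d + (wt r)%:Z) (fun z => crd r z * f z)
| wdegD d f g : wdeg d f -> wdeg d g -> wdeg d (fun z => f z + g z).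

Lemma wdeg_ext d f g : wdeg d f -> f =1 g -> wdeg d g.
Proof. by move=> ? /funext<-. Qed.

Lemma wdegW d d' f : wdeg d f -> d <= d' -> wdeg d' f.
Proof.
move=> df; elim: df d' => {d f} [d d' _|d c d0 d' dd'|d r f rn _ ih d' dd'|].
- exact: wdeg0.
- by apply: wdegC; lia.
- rewrite (_ : d' = (d' - (wt r)%:Z) + (wt r)%:Z); last lia.
  by apply: wdegX => //; apply: ih; lia.
- by move=> d f g _ ihf _ ihg d' dd'; apply: wdegD; [exact: ihf|exact: ihg].
Qed.

Lemma wdegM d d' f g : wdeg d f -> wdeg d' g ->
  wdeg (d + d') (fun z => f z * g z).
Proof.
move=> df d'g; elim: df => {d f} [d|d c d0|d r f rn _ ih|d f h _ ihf _ ihh].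
- by apply: (wdeg_ext (wdeg0 _)) => z; rewrite mul0r.
- elim: d'g => {d' g} [e|e b e0|e r f rn _ ih|e f h _ ihf _ ihh].
  + by apply: (wdeg_ext (wdeg0 _)) => z; rewrite mulr0.
  + by apply: wdegC; lia.
  + rewrite addrA; apply: (wdeg_ext (wdegX rn ih)) => z; ring.
  + by apply: (wdeg_ext (wdegD ihf ihh)) => z; ring.
- rewrite addrAC; apply: (wdeg_ext (wdegX rn ih)) => z; ring.
- by apply: (wdeg_ext (wdegD ihf ihh)) => z; ring.
Qed.

Lemma wdegZ d c f : wdeg d f -> wdeg d (fun z => c * f z).
Proof. by move=> df; rewrite -[d]add0r; apply: wdegM => //; apply: wdegC. Qed.

Lemma wdegB d f g : wdeg d f -> wdeg d g -> wdeg d (fun z => f z - g z).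
Proof.
move=> df /(wdegZ (-1)) dg; apply: (wdeg_ext (wdegD df dg)) => z; ring.
Qed.

Lemma wdeg_crd d r : (r <= n)%N -> (wt r)%:Z <= d -> wdeg d (crd r).
Proof.
move=> rn rd; apply: (@wdegW (0 + (wt r)%:Z)); last by rewrite add0r.
have d1 : wdeg 0 (fun=> 1) by exact: wdegC.
by apply: (wdeg_ext (wdegX rn d1)) => z; rewrite mulr1.
Qed.

Lemma wdeg_neg d f : wdeg d f -> d < 0 -> forall z, f z = 0.
Proof.
elim=> {d f} // [d c ? ?|d r f _ _ ih dr z|d f g _ ihf _ ihg d0 z].
- lia.
- by rewrite ih ?mulr0//; lia.
- by rewrite ihf// ihg// addr0.
Qed.

(** A coordinate of weight above [d] can only occur with a cofactor of negative degree, which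
    vanishes. *)
Lemma wdeg_indep d f z z' : wdeg d f ->
    (forall s, (s <= n)%N -> (wt s)%:Z <= d -> crd s z = crd s z') ->
  f z = f z'.
Proof.
elim=> {d f} // [d r f rn df ih zz'|d f g _ ihf _ ihg zz']; last first.
  by rewrite ihf// ihg.
have [d0|d0] := ltP d 0; first by rewrite !(wdeg_neg df d0) !mulr0.
rewrite (zz' r) ?ih// => [s sn sd|]; last lia.
by apply: zz' => //; lia.
Qed.

(* [f |-> f \o g] differs from the identity by an operator of weight [- i]. *)
Definition lowers (i : int) (g : Z -> Z) :=
  forall d f, wdeg d f -> wdeg (d - i) (fun z => f (g z) - f z).

(** Composition with [g] is multiplicative, so a product rule reduces the claim to the coordinates.
    The sign of [i] keeps the degree of [crd r (g z)] at most [wt r]. *)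
Lemma lowers_crd i g : 0 <= i ->
    (forall r, (r <= n)%N ->
       wdeg ((wt r)%:Z - i) (fun z => crd r (g z) - crd r z)) ->
  lowers i g.
Proof.
move=> i0 gi d f; elim=> {d f} [d|d c d0|d r f rn df ih|d f h _ ihf _ ihh].
- by apply: (wdeg_ext (wdeg0 _)) => z; rewrite subrr.
- by apply: (wdeg_ext (wdeg0 _)) => z; rewrite subrr.
- have rg : wdeg (wt r)%:Z (fun z => crd r (g z)).
    have dr : wdeg (wt r)%:Z (crd r) by apply: wdeg_crd.
    apply: (wdeg_ext (wdegD dr (wdegW (gi _ rn) _))) => [|z]; first lia.
    by rewrite addrC subrK.
  rewrite (_ : _ - i = (wt r)%:Z + (d - i)); last lia.
  have h2 := wdegM (gi _ rn) df.
  rewrite (_ : _ - i + d = (wt r)%:Z + (d - i)) in h2; last lia.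
  apply: (wdeg_ext (wdegD (wdegM rg ih) h2)) => z; ring.
- by apply: (wdeg_ext (wdegD ihf ihh)) => z; ring.
Qed.

Lemma lowers_comp_wdeg i g d f : 0 <= i -> lowers i g -> wdeg d f ->
  wdeg d (fun z => f (g z)).
Proof.
move=> i0 gi df; apply: (wdeg_ext (wdegD df (wdegW (gi _ _ df) _))) => [|z].
  by lia.
by rewrite addrC subrK.
Qed.

Lemma lowersW i j g : j <= i -> lowers i g -> lowers j g.
Proof. by move=> ji gi d f /gi dg; apply: (wdegW dg); lia. Qed.

Lemma lowers_comp i g h : 0 <= i -> lowers i g -> lowers i h ->
  lowers i (fun z => g (h z)).
Proof.
move=> i0 gi hi d f df.
apply: (wdeg_ext (wdegD (lowers_comp_wdeg i0 hi (gi _ _ df)) (hi _ _ df))).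
by move=> z; rewrite addrA subrK.
Qed.

(** If A f is f composed with [g] minus f, then f composed with [g'] is f minus A f composed with
    [g']. As A strictly lowers degrees, induction on the degree shows that composition with [g']
    preserves them. *)
Lemma lowers_inv i g g' : 0 < i -> cancel g' g -> lowers i g -> lowers i g'.
Proof.
move=> i0 gK gi.
have inv_wdeg d f : wdeg d f -> wdeg d (fun z => f (g' z)).
  have [m] : exists m : nat, d < m%:Z by exists `|d|%N.+1; lia.
  elim: m d f => [|m ih] d f dm df.
    by apply: (wdeg_ext (wdeg0 _)) => z; rewrite (wdeg_neg df).
  have di : wdeg (d - i) (fun z => f z - f (g' z)).
    apply: (wdeg_ext (ih _ _ _ (gi _ _ df))) => [|z]; first lia.
    by rewrite gK.
  apply: (wdeg_ext (wdegB df (wdegW di _))) => [|z]; first lia.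
  by rewrite opprB addrC subrK.
move=> d f df.
apply: (wdeg_ext (wdegZ (-1) (inv_wdeg _ _ (gi _ _ df)))) => z.
by rewrite gK mulN1r opprB.
Qed.

(* [a l] is the image of the coordinate [crd l] under the leading part, of
   weight [- i], of the operator [f |-> f \o g - f]. *)
Definition leading (i : int) (a : nat -> Z -> K) (g : Z -> Z) :=
  lowers i g /\ forall l, (l <= n)%N ->
    wdeg ((wt l)%:Z - i - 1) (fun z => crd l (g z) - crd l z - a l z).

(* The operators of composition with [y] and [t] being 1 + A and 1 + B, that of
   the commutator is 1 + (BA - AB) up to lower order. *)
Lemma leading_comm i j a b a' y y' t t' : 0 < i -> 0 < j ->
    cancel y y' -> cancel y' y -> cancel t t' -> cancel t' t ->
    leading i a y -> leading j (fun l _ => b l) t ->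
    (forall l, (l <= n)%N ->
       wdeg ((wt l)%:Z - i - j - 1) (fun z => a l (t z) - a l z - a' l z)) ->
  leading (i + j) a' (fun z => y (t (y' (t' z)))).
Proof.
move=> i0 j0 yK y'K tK t'K [yi ya] [tj tb] a'P.
have y'i := lowers_inv i0 y'K yi.
have t'j := lowers_inv j0 t'K tj.
pose F l z := crd l (y (t z)) - crd l (t (y z)).
pose A l z := crd l (y z) - crd l z.
pose B l z := crd l (t z) - crd l z.
have FE l z : F l z = (A l (t z) - A l z) - (B l (y z) - B l z).
  by rewrite /F /A /B; ring.
have wA l : (l <= n)%N -> wdeg ((wt l)%:Z - i) (A l).
  by move=> ln; apply: yi; apply: wdeg_crd.
have wB l : (l <= n)%N -> wdeg ((wt l)%:Z - j) (B l).
  by move=> ln; apply: tj; apply: wdeg_crd.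
have wF l : (l <= n)%N -> wdeg ((wt l)%:Z - (i + j)) (F l).
  move=> ln; have h1 := tj _ _ (wA _ ln); have h2 := yi _ _ (wB _ ln).
  apply: (wdeg_ext (wdegB (wdegW h1 _) (wdegW h2 _))) => [||z]; rewrite ?FE//.
  - by lia.
  - by lia.
have wFa l : (l <= n)%N ->
    wdeg ((wt l)%:Z - (i + j) - 1) (fun z => F l z - a' l z).
  (* The constant [b l] cancels in the difference along [y], so that BA alone contributes a leading
     part, namely [a']. *)
  move=> ln; have h1 := tj _ _ (ya _ ln); have h2 := yi _ _ (tb _ ln).
  have h3 := a'P _ ln.
  have := wdegD (wdegB (wdegW h1 _) (wdegW h2 _)) (wdegW h3 _).
  move=> /(_ ((wt l)%:Z - (i + j) - 1)) h.
  apply: (wdeg_ext (h _ _ _)) => [|||z]; [lia|lia|lia|].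
  rewrite FE /A /B; ring.
(* As [t (y (u z)) = z], the displacement by the commutator is [F] at [u z], and composition with
   [u] changes [F] in lower degree only. *)
pose u z := y' (t' z).
have u1 : lowers 1 u.
  by apply: (@lowers_comp 1 y' t') => //; [apply: lowersW y'i|apply: lowersW t'j];
     lia.
have cE l z : crd l (y (t (y' (t' z)))) - crd l z = F l (u z).
  by rewrite /F /u y'K t'K.
split.
  apply: lowers_crd => [|l ln]; first lia.
  apply: (wdeg_ext (lowers_comp_wdeg ler01 u1 (wF _ ln))) => z /=.
  by rewrite cE.
move=> l ln; have := wdegD (u1 _ _ (wF _ ln)) (wFa _ ln).
by move=> h; apply: (wdeg_ext h) => z /=; rewrite cE; ring.
Qed.

End WeightedDegree.

Arguments wdeg0 {K n} d.
Arguments wdegC {K n d} c.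
Arguments wdeg_crd {K n d r}.

(** * Commutators of the flows of U and V *)

Section Unipotent.
Context (K : numFieldType) (n : nat).
Local Notation Z := 'rV[K]_n.+1.
Local Notation crd := (@crd K n).
Variable G : set (Z -> Z).
Hypothesis hG : map_group G.

Lemma map_group_iter g p : G g -> G (iter p g).
Proof.
case: hG => [Gid Gcomp _] Gg; elim: p => [|p ih].
  by rewrite (_ : iter 0 g = id).
by rewrite (_ : iter p.+1 g = g \o iter p g); [exact: Gcomp|].
Qed.

(* [leadV r l] is the [crd l]-component of a field: [leadV 0] is V itself, and
   [leadV r.+1] is the Lie bracket of d/d([crd r]) and [leadV r]. *)
Definition leadV (r l : nat) (z : Z) : K :=
  if l == r then (if r is r'.+1 then 3 * crd r' z ^+ 2 else 1)
  else if (r < l)%N then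
    (\prod_(r <= s < l.-1) crd s z) * crd l.-1 z ^+ 3
  else 0.

Definition elt (i : int) (a : nat -> Z -> K) (g : Z -> Z) :=
  [/\ 0 < i, G g & exists g', [/\ cancel g g', cancel g' g & leading i a g]].

Lemma elt_comm i j a b a' y t : elt i a y -> elt j (fun l _ => b l) t ->
    (forall l, (l <= n)%N ->
       wdeg ((wt l)%:Z - i - j - 1) (fun z => a l (t z) - a l z - a' l z)) ->
  exists c, elt (i + j) a' c.
Proof.
move=> [i0 Gy [y' [yK y'K ya]]] [j0 Gt [t' [tK t'K tb]]] a'P.
have [_ Gcomp Ginv] := hG.
have Gy' := Ginv _ _ Gy yK y'K; have Gt' := Ginv _ _ Gt tK t'K.
exists (y \o t \o y' \o t'); split; first lia.
  by do !apply: (Gcomp) => //.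
exists (t \o y \o t' \o y'); split=> [z|z|] /=.
- by rewrite yK tK y'K t'K.
- by rewrite tK yK t'K y'K.
- exact: (leading_comm i0 j0 yK y'K tK t'K ya tb a'P).
Qed.

(** * Differentiation of [leadV r] along x_r *)

Section ChainStep.
Variables (r : nat) (c : K) (t : Z -> Z).
Hypothesis rn : (r <= n)%N.
Hypothesis tc : leading (wt r)%:Z (fun l _ => if l == r then c else 0) t.

(** The derivation c d/dx_r, which is the leading part of [t], kills [m]: composition with [t]
    lowers its degree by more than [wt r]. *)
Let flat d m := wdeg d m /\ wdeg (d - (wt r)%:Z - 1) (fun z => m (t z) - m z).

(** The error term on x_r has degree -1, hence it vanishes identically. *)
Lemma leading_wtP z : crd r (t z) = crd r z + c.
Proof.
have := tc.2 _ rn; rewrite eqxx => /wdeg_neg/(_ _ z) h.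
have /h : (wt r)%:Z - (wt r)%:Z - 1 < 0 :> int by lia.
by move=> /eqP; rewrite subr_eq0 => /eqP h1; rewrite -h1; ring.
Qed.

Lemma leading_lt_wt s z : (s < r)%N -> crd s (t z) = crd s z.
Proof.
move=> sr; have := tc.2 _ (leq_trans (ltnW sr) rn).
rewrite (ltn_eqF sr) => /wdeg_neg/(_ _ z) h.
have /h : (wt s)%:Z - (wt r)%:Z - 1 < 0 :> int by have := ltn_wt sr; lia.
by move=> /eqP; rewrite subr0 subr_eq0 => /eqP.
Qed.

Lemma flat_crd s : (s <= n)%N -> s != r -> flat (wt s)%:Z (crd s).
Proof.
move=> sn sr; split; first exact: wdeg_crd.
have := tc.2 _ sn; rewrite (negbTE sr) => h.
by apply: (wdeg_ext h) => z; rewrite subr0.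
Qed.

Lemma flatM d d' m m' : flat d m -> flat d' m' ->
  flat (d + d') (fun z => m z * m' z).
Proof.
move=> [dm dm'] [d'm d'm']; split; first exact: wdegM.
have t1 : wdeg d (fun z => m (t z)).
  by apply: (@lowers_comp_wdeg _ _ (wt r)) => //; case: tc.
have h1 := wdegM t1 d'm'; have h2 := wdegM dm' d'm.
rewrite (_ : d - _ - 1 + d' = d + (d' - (wt r)%:Z - 1)) in h2; last lia.
rewrite (_ : d + d' - _ - 1 = d + (d' - (wt r)%:Z - 1)); last lia.
by apply: (wdeg_ext (wdegD h1 h2)) => z; ring.
Qed.

Lemma flat_exp d m p : flat d m -> flat (d *+ p) (fun z => m z ^+ p).
Proof.
move=> dm; elim: p => [|p ih].
  split; first by rewrite mulr0n; apply: wdegC.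
  by apply: (wdeg_ext (wdeg0 _)) => z; rewrite !expr0 subrr.
rewrite mulrS (_ : (fun z => _) = fun z => m z * m z ^+ p); first exact: flatM.
by apply/funext => z; rewrite exprS.
Qed.

Lemma flat_prod a b : (b <= n.+1)%N -> (r < a)%N ->
  flat (\sum_(a <= s < b) wt s)%:Z (fun z => \prod_(a <= s < b) crd s z).
Proof.
elim: b => [|b ih] bn ra.
  rewrite big_geq// (_ : (fun z => _) = fun=> 1); last first.
    by apply/funext => z; rewrite big_geq.
  split; first exact: wdegC.
  by apply: (wdeg_ext (wdeg0 _)) => z; rewrite subrr.
have [ab|ba] := leqP a b; last first.
  rewrite big_geq// (_ : (fun z => _) = fun=> 1); last first.
    by apply/funext => z; rewrite big_geq.
  split; first exact: wdegC.
  by apply: (wdeg_ext (wdeg0 _)) => z; rewrite subrr.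
rewrite big_nat_recr//= PoszD.
rewrite (_ : (fun z => _) = fun z => (\prod_(a <= s < b) crd s z) * crd b z).
  apply: flatM; first exact: ih (ltnW bn) ra.
  by apply: flat_crd => //; rewrite gtn_eqF// (leq_trans ra).
by apply/funext => z; rewrite big_nat_recr.
Qed.

Lemma flat_monomial l : (r.+1 < l)%N -> (l <= n)%N ->
  flat ((wt l)%:Z - (wo r.+1)%:Z)
    (fun z => (\prod_(r.+1 <= s < l.-1) crd s z) * crd l.-1 z ^+ 3).
Proof.
case: l => // l; rewrite ltnS => rl ln /=.
rewrite (_ : _ - _ = (\sum_(r.+1 <= s < l) wt s)%:Z + (wt l)%:Z *+ 3); last first.
  by rewrite wtS (wo_sum rl); lia.
apply: flatM; first by apply: flat_prod => //; lia.
by apply: flat_exp; apply: flat_crd; lia.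
Qed.

(** Up to lower degree, the difference along [t] is the derivative along c d/dx_r. The component of
    index r + 1 is x_r^3, those of higher index are x_r times a flat monomial, and the others do not
    involve x_r. *)
Lemma leadV_diff eta l : (l <= n)%N ->
  wdeg ((wt l)%:Z - (wo r)%:Z - (wt r)%:Z - 1) (fun z =>
    eta * leadV r l (t z) - eta * leadV r l z - c * eta * leadV r.+1 l z).
Proof.
move=> ln; rewrite /leadV.
have zero d (f : Z -> K) : (forall z, f z = 0) -> wdeg d f.
  by move=> f0; apply: (wdeg_ext (wdeg0 _)) => z; rewrite f0.
have [lr|rl|->] := ltngtP l r.
- rewrite (ltn_eqF (ltnW _))// ltnNge (ltnW (ltnW _))//; apply: zero => z /=; ring.
- have [lr|] := eqVneq l r.+1.
    subst l; rewrite wtS /=.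
    (* This is what remains of eta ((x_r + c)^3 - x_r^3) after removal of the leading term 3 c eta
       x_r^2. *)
    have h : wdeg (2 * (wt r)%:Z - 1)
        (fun z => eta * 3 * c ^+ 2 * crd r z + eta * c ^+ 3).
      apply: wdegD; last by apply: wdegC; have := wt_gt0 r; lia.
      by apply/wdegZ/wdeg_crd => //; have := wt_gt0 r; lia.
    rewrite (_ : _ - 1 = 2 * (wt r)%:Z - 1); last lia.
    apply: (wdeg_ext h) => z.
    by rewrite !big_geq// leading_wtP; ring.
  move=> lr; have rl' : (r.+1 < l)%N by lia.
  rewrite rl'; have [m1 m2] := flat_monomial rl' ln.
  have cr : wdeg (wt r)%:Z (fun z => crd r z + c).
    by apply: wdegD; [exact: wdeg_crd|exact: wdegC].
  have := wdegZ eta (wdegM m2 cr); rewrite woS => h.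
  apply: (wdeg_ext (wdegW h _)) => [|z]; first lia.
  have rl1 : (r < l.-1)%N by lia.
  rewrite ![\prod_(r <= s < _) _]big_ltn// leading_wtP; ring.
- rewrite (ltn_eqF (ltnSn r)) ltnNge leqnSn/=; apply: zero => z.
  have low s : s.+1 = r -> crd s (t z) = crd s z.
    by move=> sr; apply: leading_lt_wt; rewrite -sr.
  by case: (r) low => [_|r' ->//]; ring.
Qed.
End ChainStep.
End Unipotent.

(** * Translations and shears obtained from iterated commutators *)

Section Movers.
Context (K : numFieldType) (n : nat).
Local Notation Z := 'rV[K]_n.+1.
Local Notation crd := (@crd K n).
Variable G : set (Z -> Z).
Hypothesis hG : map_group G.
Variables phi tau : Z -> Z.
Hypothesis phiP : elt G 1 (fun l => @leadV K n 0 l) phi.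
Hypothesis tauP : elt G 1 (fun l _ => if l == 0%N then 1 else 0) tau.

Lemma elt_ext i a b g : elt G i a g -> (forall l z, (l <= n)%N -> a l z = b l z) ->
  elt G i b g.
Proof.
move=> [i0 Gg [g' [gK g'K [gi ga]]]] ab; split=> //; exists g'; split=> //.
by split=> // l ln; apply: (wdeg_ext (ga _ ln)) => z; rewrite ab.
Qed.

Lemma elt_leading i a g : elt G i a g -> leading i a g.
Proof. by case=> _ _ [g' []]. Qed.

Lemma elt_leadV_next r y eta t c : (r <= n)%N ->
    elt G (wo r) (fun l z => eta * leadV r l z) y ->
    elt G (wt r) (fun l _ => if l == r then c else 0) t ->
  exists y', elt G (wo r.+1) (fun l z => c * eta * leadV r.+1 l z) y'.
Proof.
move=> rn yP tP; rewrite woS PoszD.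
have tb := elt_leading tP.
by apply: (elt_comm hG yP tP) => l ln; exact: (leadV_diff rn tb).
Qed.

(** In [leadV r.+1] only the component of index r + 1 contains x_r, as 3 x_r^2. A further bracket
    with d/dx_r therefore leaves a multiple of x_r d/dx_(r+1). *)
Lemma elt_shear_next r y eta t c : (r < n)%N ->
    elt G (wo r.+1) (fun l z => eta * leadV r.+1 l z) y ->
    elt G (wt r) (fun l _ => if l == r then c else 0) t ->
  exists e, elt G ((wo r.+1)%:Z + wt r)
    (fun l z => if l == r.+1 then 6 * c * eta * crd r z else 0) e.
Proof.
move=> rn yP tP; have tb := elt_leading tP; have rn' := ltnW rn.
apply: (elt_comm hG yP tP) => l ln; rewrite /leadV.
have [->|lr] := eqVneq l r.+1.
  have h := wdegC (K := K) (n := n) (3 * eta * c ^+ 2).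
  apply: (wdeg_ext (h ((wt r.+1)%:Z - (wo r.+1)%:Z - (wt r)%:Z - 1) _)) => [|z].
    by rewrite wtS woS; have := wt_gt0 r; lia.
  rewrite (leading_wtP rn' tb); ring.
case: ltnP => rl; last by apply: (wdeg_ext (wdeg0 _)) => z; ring.
have [_ /(wdegZ eta) m2] := flat_monomial rn' tb rl ln.
by apply: (wdeg_ext m2) => z; ring.
Qed.

(** One more bracket with d/dx_r turns x_r d/dx_(r+1) into a constant field; the three brackets
    lower weights by [wo r + 3 * wt r] in total, which is [wt r.+1]. *)
Lemma elt_translation_next r e kappa t c : (r < n)%N ->
    elt G ((wo r.+1)%:Z + wt r) (fun l z => if l == r.+1 then kappa * crd r z else 0) e ->
    elt G (wt r) (fun l _ => if l == r then c else 0) t ->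
  exists t', elt G (wt r.+1) (fun l z => if l == r.+1 then kappa * c else 0) t'.
Proof.
move=> rn eP tP; have tb := elt_leading tP; have rn' := ltnW rn.
rewrite (_ : (wt r.+1)%:Z = (wo r.+1)%:Z + wt r + wt r); last first.
  by rewrite wtS woS; lia.
apply: (elt_comm hG eP tP) => l ln; apply: (wdeg_ext (wdeg0 _)) => z.
case: eqP => _; last by ring.
rewrite (leading_wtP rn' tb); ring.
Qed.

Lemma elt_chain r : (r <= n)%N -> exists y eta t c,
  [/\ eta != 0, c != 0, elt G (wo r) (fun l z => eta * leadV r l z) y &
      elt G (wt r) (fun l _ => if l == r then c else 0) t].
Proof.
elim: r => [|r ih] rn.
  exists phi, 1, tau, 1; split; rewrite ?oner_eq0//.
  by apply: (elt_ext phiP) => l z _; rewrite mul1r.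
have [y [eta [t [c [eta0 c0 yP tP]]]]] := ih (ltnW rn).
have [y' y'P] := elt_leadV_next (ltnW rn) yP tP.
have [e eP] := elt_shear_next rn y'P tP.
have [t' t'P] := elt_translation_next rn eP tP.
exists y', (c * eta), t', (6 * c * (c * eta) * c).
by rewrite !mulf_neq0// pnatr_eq0.
Qed.

Definition triangular (g : Z -> Z) := forall l z z', (l <= n)%N ->
  (forall s, (s < l)%N -> crd s z = crd s z') ->
  crd l (g z) - crd l z = crd l (g z') - crd l z'.

Lemma triangular_agree g l z z' : triangular g -> (l <= n.+1)%N ->
    (forall s, (s < l)%N -> crd s z = crd s z') ->
  forall s, (s < l)%N -> crd s (g z) = crd s (g z').
Proof.
move=> gtri ln zz' s sl; have sn : (s <= n)%N by lia.
have /(gtri _ _ _ sn) : forall i, (i < s)%N -> crd i z = crd i z'.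
  by move=> i si; apply: zz'; lia.
by rewrite zz'// => /addIr.
Qed.

Lemma triangular_comp u v : triangular u -> triangular v ->
  triangular (u \o v).
Proof.
move=> ut vt l z z' ln zz'.
have /(ut _ _ _ ln) h1 := triangular_agree vt (leqW ln) zz'.
have h2 := vt _ _ _ ln zz'.
by rewrite -(subrKA (crd l (v z))) h1 h2 subrKA.
Qed.

(** The coordinates of a preimage are recovered one at a time: when those below s agree, [g]
    displaces x_s by equal amounts, so the values of x_s agree too. *)
Lemma triangular_inv g g' : cancel g' g -> triangular g -> triangular g'.
Proof.
move=> g'K gtri.
have agree l z z' : (l <= n)%N -> (forall s, (s < l)%N -> crd s z = crd s z') ->
    forall s, (s < l)%N -> crd s (g' z) = crd s (g' z').
  move=> ln zz'; elim/ltn_ind => s ih sl; have sn : (s <= n)%N by lia.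
  have /(gtri _ _ _ sn) : forall i, (i < s)%N -> crd i (g' z) = crd i (g' z').
    by move=> i si; apply: ih => //; lia.
  by rewrite !g'K zz'// => /addrI/oppr_inj.
move=> l z z' ln zz'; have /(gtri _ _ _ ln) := agree _ _ _ ln zz'.
by rewrite !g'K => /(congr1 -%R); rewrite !opprB.
Qed.

Definition tame (k : nat) (g : Z -> Z) :=
  [/\ G g, exists g', cancel g g' /\ cancel g' g, triangular g &
      forall s z, (s < k)%N -> crd s (g z) = crd s z].

(** The displacement of x_l has degree [wt l - i], so it only involves coordinates of smaller
    weight, and it vanishes when [wt l < i]. *)
Lemma elt_tame i a g k : elt G i a g -> (k <= n)%N ->
  (forall s, (s < k)%N -> (wt s)%:Z < i) -> tame k g.
Proof.
move=> [i0 Gg [g' [gK g'K [gi ga]]]] kn ki; split=> //.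
- by exists g'.
- move=> l z z' ln zz'; have := wdeg_indep (gi _ _ (wdeg_crd ln (lexx _))); apply.
  move=> s sn sl; apply: zz'; rewrite ltnNge; apply/negP => /leq_wt; lia.
- move=> s z sk; have sn : (s <= n)%N by lia.
  have /wdeg_neg/(_ _ z) h := gi _ _ (wdeg_crd sn (lexx _)).
  by apply/eqP; rewrite -subr_eq0 h//; have := ki _ sk; lia.
Qed.

Definition mover (k l : nat) (g : Z -> Z) := tame k g /\
  exists eta rho, [/\ eta != 0,
    forall z z', (forall s, (s < l)%N -> crd s z = crd s z') -> rho z = rho z' &
    forall z, crd k (g z) = crd k z + eta * crd l z + rho z].

Lemma translation k : (k <= n)%N ->
  exists g c, [/\ c != 0, tame k g & forall z, crd k (g z) = crd k z + c].
Proof.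
move=> kn; have [_ [_ [t [c [_ c0 _ tP]]]]] := elt_chain kn.
exists t, c; split=> //; last exact: (leading_wtP kn (elt_leading tP)).
by apply: (elt_tame tP kn) => s sk; have := ltn_wt sk; lia.
Qed.

(** The error on x_(r+1) has degree [wt r.+1 - (wo r.+1 + wt r) - 1], that is [wt r - 1], so it
    depends only on coordinates lighter than x_r. *)
Lemma moverS r : (r < n)%N -> exists g, mover r.+1 r g.
Proof.
move=> rn; have [y [eta [t [c [eta0 c0 yP tP]]]]] := elt_chain (ltnW rn).
have [y' y'P] := elt_leadV_next (ltnW rn) yP tP.
have [e eP] := elt_shear_next rn y'P tP; exists e; split.
  apply: (elt_tame eP rn) => s; rewrite ltnS => /leq_wt.
  by have := wo_gt0 r.+1; lia.
have := (elt_leading eP).2 _ rn; rewrite eqxx; set rho := (fun z => _) => wrho.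
exists (6 * c * (c * eta)), rho; split.
- by rewrite !mulf_neq0// pnatr_eq0.
- move=> z z' zz'; apply: (wdeg_indep wrho) => s sn sr; apply: zz'.
  rewrite ltnNge; apply/negP => /leq_wt; move: sr; rewrite wtS woS.
  by have := wt_gt0 r; lia.
- by move=> z; rewrite /rho; ring.
Qed.

(** In the commutator, x_k changes by the difference of eta x_(l+1) + rho before and after [e]. As
    [e] fixes x_0, ..., x_l, the part rho cancels, and there remains eta times the displacement of
    x_(l+1) by [e]. *)
Lemma mover_comm k l g e : (l.+1 < k)%N -> (k <= n)%N ->
  mover k l.+1 g -> mover l.+1 l e -> exists g', mover k l g'.
Proof.
move=> lk kn [[Gg [g' [gK g'K]] gtri gfix] [eta [rho [eta0 rhoP gk]]]].
move=> [[Ge [e' [eK e'K]] etri efix] [eta' [rho' [eta'0 rho'P ek]]]].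
have [_ Gcomp Ginv] := hG.
have Gg' := Ginv _ _ Gg gK g'K; have Ge' := Ginv _ _ Ge eK e'K.
have g'tri := triangular_inv g'K gtri; have e'tri := triangular_inv e'K etri.
pose c := g \o e \o g' \o e'; pose u := g' \o e'.
have uK z : e (g (u z)) = z by rewrite /u/= g'K e'K.
have cE z : c z = g (e (u z)) by [].
exists c; split; first split.
- by do !apply: (Gcomp) => //.
- exists (e \o g \o e' \o g'); split=> z; rewrite /c/=.
  + by rewrite gK eK g'K e'K.
  + by rewrite eK gK e'K g'K.
- by do !apply: triangular_comp => //.
- move=> s z sk; rewrite cE gfix// -{2}[z]uK.
  have sn : (s <= n)%N by lia.
  have /(etri _ _ _ sn) h : forall i, (i < s)%N -> crd i (g (u z)) = crd i (u z).
    by move=> i si; rewrite gfix//; lia.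
  by apply/eqP; rewrite -subr_eq0 -(subrKA (crd s (u z))) -h gfix// subrKA subrr.
exists (eta * eta'), (fun z => eta * rho' z); split.
- by rewrite mulf_neq0.
- by move=> z z' zz'; rewrite (rho'P z z').
move=> z; rewrite cE gk; have -> : crd k z = crd k (e (g (u z))) by rewrite uK.
(* Since [g] fixes the coordinates below k, the triangular map [e] displaces x_k equally at [u z]
   and at [g (u z)]. *)
have /(etri _ _ _ kn) h : forall i, (i < k)%N -> crd i (g (u z)) = crd i (u z).
  by move=> i si; rewrite gfix//; lia.
have low i : (i <= l)%N -> crd i (u z) = crd i z.
  by move=> il; rewrite -[in RHS](uK z) efix ?gfix//; lia.
have -> : rho (e (u z)) = rho (u z).
  by apply: rhoP => s sl; rewrite efix.
have -> : rho' z = rho' (u z) by apply: rho'P => s sl; rewrite low//; lia.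
rewrite ek -(low l)//.
have -> : crd k (e (g (u z))) = crd k (e (u z)) - crd k (u z) + crd k (g (u z)).
  by rewrite -h subrK.
rewrite gk; ring.
Qed.

Lemma mover_exists k l : (l < k)%N -> (k <= n)%N -> exists g, mover k l g.
Proof.
move=> lk kn; have [d kE] : exists d, k = (l + d).+1 by exists (k - l.+1)%N; lia.
elim: d l lk kE => [|d ih] l lk kE.
  by rewrite kE addn0; apply: moverS; lia.
have lk' : (l.+1 < k)%N by lia.
have [//||g gP] := ih l.+1; first by lia.
have [|e eP] := @moverS l; first by lia.
exact: mover_comm lk' kn gP eP.
Qed.
End Movers.

(** * Transitivity on generic tuples *)

Section Generic.
Context (K : numFieldType).

(** The product of the polynomials has finitely many roots, while the naturals are distinct in [K].
    A natural value is wanted because it mostly serves as the number of iterations of a map. *)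
Lemma common_nonroot (I : finType) (q : I -> {poly K}) :
  (forall i, q i != 0) -> exists p : nat, forall i, (q i).[p%:R] != 0.
Proof.
move=> q0; pose Q := \prod_i q i.
have Q0 : Q != 0 by apply/prodf_neq0.
have [p Qp] : exists p : nat, Q.[p%:R] != 0.
  apply: contrapT => noroot.
  pose rs : seq K := [seq p%:R | p <- iota 0 (size Q)].
  have rsQ : all (root Q) rs.
    apply/allP => _ /mapP[p _ ->]; apply/negPn/negP => Qp.
    by apply: noroot; exists p.
  have rsU : uniq rs.
    by rewrite map_inj_uniq ?iota_uniq// => a b /eqP; rewrite eqr_nat => /eqP.
  by have := max_poly_roots Q0 rsQ rsU; rewrite size_map size_iota ltnn.
exists p => i; apply: contraNneq Qp => qp.
by rewrite /Q (bigD1 i)//= hornerM qp mul0r.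
Qed.

Lemma linear_poly_neq0 (a b : K) :
  (a != 0) || (b != 0) -> a%:P + b *: 'X != 0.
Proof.
apply: contraTneq => ab0.
have := congr1 (fun p : {poly K} => p`_0) ab0.
have := congr1 (fun p : {poly K} => p`_1) ab0.
by rewrite !coefD !coefZ !coefX !coefC/= mulr0 mulr1 add0r addr0 => -> ->; rewrite eqxx.
Qed.

(** The two squares have different degrees, 2(i+1) and 2(j+1). *)
Lemma sqr_scaled_neq (i j : nat) (a b p q : K) : i != j -> p != 0 -> q != 0 ->
  ((p *: ('X^(i.+1) + a%:P)) ^+ 2 - (q *: ('X^(j.+1) + b%:P)) ^+ 2) != 0.
Proof.
have sz k (c d : K) : d != 0 -> size ((d *: ('X^(k.+1) + c%:P)) ^+ 2) = (k.+1 * 2).+1.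
  move=> d0; have s1 : size ('X^(k.+1) + c%:P) = k.+2.
    by rewrite size_polyDl size_polyXn// size_polyC; case: (c == 0).
  rewrite exprZn size_scale ?expf_neq0//.
  have := size_exp ('X^(k.+1) + c%:P) 2; rewrite s1/= => <-.
  by rewrite prednK// lt0n size_poly_eq0 expf_neq0// -size_poly_eq0 s1.
move=> ij p0 q0; rewrite subr_eq0; apply: contraNneq ij => h.
by have := congr1 (fun p : {poly K} => size p) h; rewrite /= !sz// => -[] /eqP; lia.
Qed.
End Generic.

(** * Moving tuples into good position and connecting good tuples *)

Section Transitivity.
Context (K : numFieldType) (n : nat).
Local Notation Z := 'rV[K]_n.+1.
Local Notation crd := (@crd K n).
Variable G : set (Z -> Z).
Hypothesis hG : map_group G.
Hypothesis G_bij : forall g, G g -> exists g', cancel g g' /\ cancel g' g.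
Hypothesis n_gt0 : (0 < n)%N.

(** The factor x_n is kept apart because markers are made distinct by changing x_n alone. *)
Definition cofactor_W (z : Z) : K := \prod_(1 <= r < n) crd r z.
Definition marker (z : Z) : K := (crd n z * cofactor_W z) ^+ 2.

Hypothesis G_translation : forall k, (k <= n)%N ->
  exists g c, [/\ c != 0, tame G k g & forall z, crd k (g z) = crd k z + c].
Hypothesis G_mover : forall k l, (l < k)%N -> (k <= n)%N ->
  exists g, mover G k l g.
Hypothesis G_marker : forall m (X : 'I_m -> Z) (v : 'I_m -> K),
  injective (marker \o X) -> exists2 g, G g & forall i,
    crd 0 (g (X i)) = v i /\
    forall s, (0 < s <= n)%N -> crd s (g (X i)) = crd s (X i).

Lemma cofactor_W_agree z z' :
    (forall r, (0 < r < n)%N -> crd r z = crd r z') ->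
  cofactor_W z = cofactor_W z'.
Proof. by move=> zz'; apply: eq_big_nat => r; apply: zz'. Qed.

Lemma marker_agree z z' : (forall r, (0 < r <= n)%N -> crd r z = crd r z') ->
  marker z = marker z'.
Proof.
move=> zz'; rewrite /marker zz' ?n_gt0//=; congr ((_ * _) ^+ 2).
by apply: cofactor_W_agree => r /andP[r0 rn]; rewrite zz'// r0 ltnW.
Qed.

Lemma cofactor_W_neq0 z : (forall r, (0 < r < n)%N -> crd r z != 0) ->
  cofactor_W z != 0.
Proof.
move=> z0; rewrite /cofactor_W prodf_seq_neq0; apply/allP => r.
by rewrite mem_index_iota => rn; rewrite implyTb z0.
Qed.

Definition good_tuple m (X : 'I_m -> Z) :=
  (forall i r, (0 < r <= n)%N -> crd r (X i) != 0) /\ injective (marker \o X).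

Definition set_crd (z : Z) r v : Z := \row_j if j == inord (n - r) then v else z 0 j.

Lemma crd_set_crd z r v s : (r <= n)%N -> (s <= n)%N ->
  crd s (set_crd z r v) = if s == r then v else crd s z.
Proof.
move=> rn sn; rewrite /crd mxE; case: (eqVneq s r) => [->|sr].
  by rewrite eqxx.
case: eqP => // /(congr1 val); rewrite /= !inordK ?ltnS ?leq_subr// => h.
by case/eqP: sr; lia.
Qed.

Lemma tame_inj k g : tame G k g -> injective g.
Proof. by case=> _ [g' [gK _]] _ _; exact: can_inj gK. Qed.

Lemma iter_tame k g p z s : tame G k g -> (s < k)%N ->
  crd s (iter p g z) = crd s z.
Proof.
by case=> _ _ _ gfix sk; elim: p => //= p; rewrite gfix.
Qed.

Lemma iter_translation k g c p z : (forall z, crd k (g z) = crd k z + c) ->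
  crd k (iter p g z) = crd k z + p%:R * c.
Proof.
by move=> gc; elim: p => [|p /= ih]; rewrite ?mul0r ?addr0// gc ih -natr1; ring.
Qed.

(** The increment of x_k depends on coordinates fixed by [g], so it is the same at each
    iteration. *)
Lemma iter_mover k l g : mover G k l g -> (l < k)%N -> exists eta rho,
  [/\ eta != 0,
      forall z z', (forall s, (s < l)%N -> crd s z = crd s z') -> rho z = rho z' &
      forall p z, crd k (iter p g z) = crd k z + p%:R * (eta * crd l z + rho z)].
Proof.
move=> [gt [eta [rho [eta0 rhoP gk]]]] lk; exists eta, rho; split=> // p z.
elim: p => [|p /= ih]; first by rewrite mul0r addr0.
rewrite gk ih (iter_tame p z gt lk) (rhoP (iter p g z) z) => [|s sl].
  by rewrite -natr1; ring.
by apply: (iter_tame p z gt); apply: ltn_trans lk.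
Qed.

(** Coordinates are treated in increasing order, since a power of a translation of x_k leaves the
    lower ones unchanged. *)
Lemma make_nonzero m (X : 'I_m -> Z) k : (k <= n)%N ->
  exists g, [/\ G g, injective g &
    forall i r, (0 < r < k)%N -> crd r (g (X i)) != 0].
Proof.
have [Gid Gcomp _] := hG.
elim: k => [_|k ih kn]; first by exists id; split=> // i r; rewrite ltn0 andbF.
have [g [Gg ginj gX]] := ih (ltnW kn).
have [h [c [c0 ht hc]]] := G_translation (ltnW kn).
have [i|p hp] := @common_nonroot K 'I_m (fun i => (crd k (g (X i)))%:P + c *: 'X).
  by apply: linear_poly_neq0; rewrite c0 orbT.
exists (iter p h \o g); split.
- by apply: (Gcomp) => //; apply: map_group_iter => //; case: ht.
- by apply: inj_comp => //; elim: p {hp} => //= p; apply/inj_comp/(tame_inj ht).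
- move=> i r /andP[r0]; rewrite ltnS leq_eqVlt => /predU1P[rk|rk] /=.
    rewrite rk (iter_translation _ _ hc); have := hp i.
    by rewrite !hornerE mulrC.
  by rewrite (iter_tame _ _ ht rk) gX ?r0.
Qed.

(** A power of a mover adds p (eta x_l + rho) to x_n. For a pair not yet separated the coordinates
    below l agree, so rho cancels and a difference in x_l appears in x_n; a generic p keeps apart
    the pairs already separated. *)
Lemma separate_crd_n m (X : 'I_m -> Z) l : (l <= n)%N ->
  exists g, [/\ G g, forall z s, (s < n)%N -> crd s (g z) = crd s z &
    forall i j, crd n (X i) <> crd n (X j) \/
        (exists2 s, (s < l)%N & crd s (X i) <> crd s (X j)) ->
      crd n (g (X i)) != crd n (g (X j))].
Proof.
have [Gid Gcomp _] := hG.
elim: l => [_|l ih ln]; first by exists id; split=> // i j [/eqP//|[]].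
have [g [Gg gfix gX]] := ih (ltnW ln).
have [h hm] := G_mover ln (leqnn n).
have [eta [rho [eta0 rhoP hn]]] := iter_mover hm ln.
pose f i := eta * crd l (X i) + rho (X i).
pose x i := crd n (g (X i)).
have hx p i : crd n (iter p h (g (X i))) = x i + p%:R * f i.
  rewrite hn (gfix _ l)// (rhoP (g (X i)) (X i))// => s sl; apply: gfix.
  exact: ltn_trans ln.
(* The value 1 stands in for the pairs which no power of the mover separates, where the difference
   is the zero polynomial. *)
pose q (ij : 'I_m * 'I_m) : {poly K} :=
  if (x ij.1 == x ij.2) && (f ij.1 == f ij.2) then 1 else
  (x ij.1 - x ij.2)%:P + (f ij.1 - f ij.2) *: 'X.
have [ij|p hp] := @common_nonroot K _ q.
  rewrite /q; case: ifPn => [_|]; first exact: oner_neq0.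
  by rewrite negb_and => xf; apply: linear_poly_neq0; rewrite !subr_eq0.
exists (iter p h \o g); split.
- by apply: (Gcomp) => //; apply: map_group_iter => //; case: hm => -[].
- by move=> z s sn; rewrite /= (iter_tame _ _ hm.1 sn) gfix.
move=> i j ij; rewrite /= !hx; have := hp (i, j); rewrite /q/=.
case: ifPn => [/andP[/eqP xij /eqP fij] _|_]; last first.
  rewrite !hornerE; apply: contraNN; rewrite -subr_eq0 => /eqP h0; apply/eqP.
  rewrite -[RHS]h0; ring.
have low : ~ (crd n (X i) <> crd n (X j) \/
    exists2 s, (s < l)%N & crd s (X i) <> crd s (X j)).
  by move=> /gX /eqP.
exfalso; case: ij => [xn|[s]]; first by apply: low; left.
rewrite ltnS leq_eqVlt => /predU1P[->|sl] xs; last by apply: low; right; exists s.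
move: fij; rewrite /f (rhoP (X i) (X j)) => [/addIr/(mulfI eta0)//|s' s'l].
by apply: contrapT => ne; apply: low; right; exists s'.
Qed.

(** First x_1, ..., x_(n-1) are made nonzero, then the values of x_n distinct; finally a generic
    translation of x_n makes it nonzero and separates the markers. *)
Lemma make_good_tuple m (X : 'I_m -> Z) : injective X ->
  exists2 g, G g & good_tuple (g \o X).
Proof.
move=> Xinj; have [Gid Gcomp _] := hG.
have [g1 [Gg1 g1inj g1X]] := make_nonzero X (leqnn n).
have [g2 [Gg2 g2fix g2X]] := separate_crd_n (g1 \o X) (leqnn n).
have [g3 [c [c0 g3t g3c]]] := G_translation (leqnn n).
pose Y i := g2 (g1 (X i)).
have Y0 i r : (0 < r < n)%N -> crd r (Y i) != 0.
  by move=> rn; rewrite /Y g2fix ?g1X//; case/andP: rn.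
have Yn i j : i != j -> crd n (Y i) != crd n (Y j).
  move=> ij; apply: g2X; apply: contrapT => /not_orP[/contrapT xn xs].
  case/eqP: ij; apply/Xinj/g1inj/crd_inj => r; rewrite leq_eqVlt.
  move=> /predU1P[->//|rn]; apply: contrapT => xr; apply: xs; by exists r.
pose P i := cofactor_W (Y i).
have P0 i : P i != 0 by apply: cofactor_W_neq0 => r; exact: Y0.
(* Markers are squares, so their difference is the product of these polynomials in p for s = 1 and s
   = -1. If the slope vanishes, the constant term is the difference of the values of x_n times
   [P i]. *)
pose L s i j : {poly K} := (crd n (Y i) * P i + s * (crd n (Y j) * P j))%:P +
  (c * (P i + s * P j)) *: 'X.
have L0 s i j : s ^+ 2 = 1 -> i != j -> L s i j != 0.
  move=> s1 ij; apply: linear_poly_neq0; rewrite mulf_eq0 (negbTE c0)/=.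
  have [Pij|] := eqVneq (P i + s * P j) 0; last by rewrite orbT.
  rewrite orbF; have -> : crd n (Y i) * P i + s * (crd n (Y j) * P j) =
      (crd n (Y i) - crd n (Y j)) * P i + crd n (Y j) * (P i + s * P j) by ring.
  by rewrite Pij mulr0 addr0 mulf_neq0// subr_eq0 Yn.
pose q (ij : 'I_m * 'I_m) : {poly K} :=
  if ij.1 == ij.2 then (crd n (Y ij.1))%:P + c *: 'X
  else L 1 ij.1 ij.2 * L (-1) ij.1 ij.2.
have [[i j]|p hp] := @common_nonroot K _ q.
  rewrite /q/=; case: ifPn => ij.
    by apply: linear_poly_neq0; rewrite c0 orbT.
  by rewrite mulf_neq0// L0// ?expr1n// sqrrN expr1n.
have cW i : cofactor_W (iter p g3 (Y i)) = P i.
  apply: cofactor_W_agree => r /andP[_ rn].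
  exact: (iter_tame _ _ g3t rn).
exists (iter p g3 \o g2 \o g1).
  by do !apply: (Gcomp) => //; apply: map_group_iter => //; case: g3t.
split=> [i r|i j] /=; rewrite -/(Y _).
  move=> /andP[r0]; rewrite leq_eqVlt => /predU1P[->|rn].
    rewrite (iter_translation _ _ g3c); have := hp (i, i); rewrite /q/= eqxx.
    by rewrite !hornerE mulrC.
  by rewrite (iter_tame _ _ g3t rn) Y0 ?r0.
rewrite -/(Y j) /marker !cW !(iter_translation _ _ g3c) => Mij.
apply/eqP; apply: contraT => ij; have := hp (i, j); rewrite /q/= (negbTE ij).
rewrite /L hornerM !hornerD !hornerC !hornerZ !hornerX => /negP; case; apply/eqP.
move/eqP: Mij; rewrite -subr_eq0 => /eqP Mij; rewrite -[RHS]Mij; ring.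
Qed.

(** The coordinates above j are chosen in increasing order. The displacement d of the next one by
    [h] is already determined, so its value v must only avoid 0 and -d. *)
Lemma fill_nonzero h z j b : triangular h -> (j <= b)%N -> (b < n)%N ->
    (forall r, (0 < r <= j)%N -> crd r z != 0 /\ crd r (h z) != 0) ->
  exists z', (forall s, (s <= j)%N -> crd s z' = crd s z) /\
    forall r, (0 < r <= b)%N -> crd r z' != 0 /\ crd r (h z') != 0.
Proof.
move=> ht jb bn zj; elim: b jb bn => [|b ih].
  by rewrite leqn0 => /eqP j0 _; exists z; split=> // r; rewrite leqn0; case: r.
rewrite leq_eqVlt => /predU1P[jb|jb] bn; first by exists z; rewrite -jb.
have [z' [z'j z'b]] := ih jb (ltnW bn).
pose d := crd b.+1 (h z') - crd b.+1 z'.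
have [v [v0 vd]] : exists v : K, v != 0 /\ v + d != 0.
  have [->|d1] := eqVneq d (-1).
    by exists 2; rewrite pnatr_eq0; split=> //; rewrite (_ : 2 - 1 = 1)//; ring.
  by exists 1; rewrite oner_eq0; split=> //; rewrite addrC -[1]opprK subr_eq0.
have agree s : (s <= b)%N -> crd s (set_crd z' b.+1 v) = crd s z'.
  move=> sb; rewrite crd_set_crd; [|lia|lia].
  by rewrite ltn_eqF.
have top : crd b.+1 (set_crd z' b.+1 v) = v by rewrite crd_set_crd ?eqxx//; lia.
exists (set_crd z' b.+1 v); split=> [s sj|r /andP[r0]].
  by rewrite agree ?z'j//; lia.
rewrite leq_eqVlt => /predU1P[rb|rb].
  rewrite rb top; split=> //.
  have /(ht _ _ _ (ltnW bn)) : forall s, (s < b.+1)%N ->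
      crd s (set_crd z' b.+1 v) = crd s z' by [].
  by rewrite top -/d => /eqP; rewrite subr_eq addrC => /eqP ->.
have [|z'r hz'r] := z'b r; first by rewrite r0.
rewrite agree//; split=> //.
have bn' : (b.+1 <= n.+1)%N by lia.
by rewrite (@triangular_agree _ _ _ b.+1 _ z').
Qed.

(** After x_(j+1), ..., x_(n-1) are filled in, x_n of the i-th point is set to p^(i+1). The products
    whose squares are the markers, at the points and at their images, are then polynomials in p of
    degree i+1, and a generic p separates them. *)
Lemma choose_good_tuple h m (X0 : 'I_m -> Z) j : triangular h -> (j < n)%N ->
    (forall i r, (0 < r <= j)%N -> crd r (X0 i) != 0 /\ crd r (h (X0 i)) != 0) ->
  exists X : 'I_m -> Z, [/\ forall i s, (s <= j)%N -> crd s (X i) = crd s (X0 i),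
    good_tuple X & good_tuple (h \o X)].
Proof.
move=> ht jn X0j.
have jn1 : (j <= n.-1)%N by lia.
have n1 : (n.-1 < n)%N by lia.
have /choice[X1 X1P] i := fill_nonzero ht jn1 n1 (X0j i).
pose d i := crd n (h (X1 i)) - crd n (X1 i).
pose P i := cofactor_W (X1 i).
pose P' i := cofactor_W (h (X1 i)).
have P0 i : P i != 0.
  by apply: cofactor_W_neq0 => r rn; apply: ((X1P i).2 r _).1; lia.
have P'0 i : P' i != 0.
  by apply: cofactor_W_neq0 => r rn; apply: ((X1P i).2 r _).2; lia.
(* Exponents start at 1, so that the added constant cannot cancel the leading term. *)
pose D (a Q : 'I_m -> K) i j : {poly K} :=
  (Q i *: ('X^((val i).+1) + (a i)%:P)) ^+ 2 - (Q j *: ('X^((val j).+1) + (a j)%:P)) ^+ 2.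
pose q (ij : 'I_m * 'I_m) : {poly K} :=
  if ij.1 == ij.2 then 'X^((val ij.1).+1) * ('X^((val ij.1).+1) + (d ij.1)%:P)
  else D (fun=> 0) P ij.1 ij.2 * D d P' ij.1 ij.2.
have [[i k]|p hp] := @common_nonroot K _ q.
  rewrite /q/=; case: ifPn => ik.
    rewrite mulf_neq0 ?monic_neq0 ?monicXn ?monicXnaddC//.
  by rewrite mulf_neq0// sqr_scaled_neq.
pose X i := set_crd (X1 i) n (p%:R ^+ (val i).+1).
have XX1 i s : (s < n)%N -> crd s (X i) = crd s (X1 i).
  by move=> sn; rewrite /X crd_set_crd ?ltn_eqF//; lia.
have hXX1 i s : (s < n)%N -> crd s (h (X i)) = crd s (h (X1 i)).
  by move=> sn; apply: (triangular_agree ht (leqnSn n)) => // r; exact: XX1.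
have Xn i : crd n (X i) = p%:R ^+ (val i).+1 by rewrite /X crd_set_crd ?eqxx.
have hXn i : crd n (h (X i)) = p%:R ^+ (val i).+1 + d i.
  have := ht n (X i) (X1 i) (leqnn n) (XX1 i).
  by rewrite Xn -/(d i) => /eqP; rewrite subr_eq addrC => /eqP.
have cX i : cofactor_W (X i) = P i.
  by apply: cofactor_W_agree => r /andP[_]; exact: XX1.
have chX i : cofactor_W (h (X i)) = P' i.
  by apply: cofactor_W_agree => r /andP[_]; exact: hXX1.
have hpi i : p%:R ^+ (val i).+1 != 0 :> K /\ p%:R ^+ (val i).+1 + d i != 0.
  by have := hp (i, i); rewrite /q eqxx/= !hornerE mulf_eq0 negb_or => /andP.
have hpD i k : i != k -> (D (fun=> 0) P i k).[p%:R] != 0 /\ (D d P' i k).[p%:R] != 0.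
  by move=> ik; have := hp (i, k); rewrite /q (negbTE ik)/= hornerM mulf_eq0 negb_or => /andP.
exists X; split.
- by move=> i s sj; rewrite XX1 ?(X1P i).1//; lia.
- split=> [i r /andP[r0]|i k]; last first.
    rewrite /= /marker !Xn !cX => M; apply/eqP; apply: contraT => /hpD[+ _].
    rewrite /D !(hornerD, hornerN, horner_exp, hornerZ, hornerX, hornerC) => /negP[]; apply/eqP.
    move/eqP: M; rewrite -subr_eq0 => /eqP M; rewrite -[RHS]M; ring.
  rewrite leq_eqVlt => /predU1P[->|rn]; first by rewrite Xn; case: (hpi i).
  by rewrite XX1//; apply: ((X1P i).2 r _).1; lia.
- split=> [i r /andP[r0]|i k]; last first.
    rewrite /= /marker !hXn !chX => M; apply/eqP; apply: contraT => /hpD[_].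
    rewrite /D !(hornerD, hornerN, horner_exp, hornerZ, hornerX, hornerC) => /negP[]; apply/eqP.
    move/eqP: M; rewrite -subr_eq0 => /eqP M; rewrite -[RHS]M; ring.
  rewrite leq_eqVlt => /predU1P[->|rn]; first by rewrite /= hXn; case: (hpi i).
  by rewrite /= hXX1//; apply: ((X1P i).2 r _).2; lia.
Qed.

(** Induction on n - j. A tuple X' is chosen which agrees with X in x_1, ..., x_(j+1) and whose
    image under a mover h agrees there with Y; the induction hypothesis connects X to X' and h X' to
    Y. *)
Lemma good_tuple_transitive j m (X Y : 'I_m -> Z) : (j <= n)%N -> good_tuple X -> good_tuple Y ->
    (forall i r, (0 < r <= j)%N -> crd r (X i) = crd r (Y i)) ->
  exists2 g, G g & forall i, g (X i) = Y i.
Proof.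
have [Gid Gcomp _] := hG.
have [d nE] : exists d, n = (j + d)%N \/ (n < j)%N.
  by exists (n - j)%N; lia.
case: nE => [nE|?]; last by lia.
elim: d j X Y nE => [|d ih] j X Y nE jn [X0 XM] [Y0 YM] XY.
  rewrite addn0 in nE; subst j.
  have [g Gg gX] := G_marker (fun i => crd 0 (Y i)) XM.
  exists g => // i; apply: crd_inj => -[_|r rn]; first by case: (gX i).
  by rewrite (gX i).2// XY.
have jn' : (j.+1 <= n)%N by lia.
have [h [ht [eta [rho [eta0 rhoP hj]]]]] := G_mover (ltn0Sn j) jn'.
have [Gh _ htri hfix] := ht.
(* With l = 0 the function rho is constant, and v is the value of x_0 for which [h] gives x_(j+1)
   its target. *)
pose v i := (crd j.+1 (Y i) - crd j.+1 (X i) - rho 0) / eta.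
pose X0' i := set_crd (X i) 0 (v i).
have X0'S i s : (0 < s <= n)%N -> crd s (X0' i) = crd s (X i).
  by move=> sn; rewrite /X0' crd_set_crd ?gtn_eqF//; lia.
have hX0' i z : (forall s, (s <= j.+1)%N -> crd s z = crd s (X0' i)) ->
    forall r, (0 < r <= j.+1)%N -> crd r (h z) = crd r (Y i).
  move=> zX r /andP[r0]; rewrite leq_eqVlt => /predU1P[->|rj]; last first.
    by rewrite hfix// zX ?X0'S ?XY//; lia.
  rewrite hj !zX// X0'S; last lia.
  rewrite /X0' crd_set_crd// eqxx (rhoP z 0)// /v mulrC divfK//; ring.
have [X' [X'X0 X'g hX'g]] : exists X' : 'I_m -> Z,
    [/\ forall i s, (s <= j.+1)%N -> crd s (X' i) = crd s (X0' i),
        good_tuple X' & good_tuple (h \o X')].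
  have [jn1|jn1] := ltnP j.+1 n.
    apply: choose_good_tuple => // i r rj; split; first by rewrite X0'S ?X0//; lia.
    by rewrite (hX0' i)// Y0//; lia.
  (* Here no coordinate is left free, but markers ignore x_0, so those of [X0'] and of its image are
     those of X and Y. *)
  have {}jn1 : j.+1 = n by lia.
  exists X0'; split=> //; split.
  - by move=> i r rn; rewrite X0'S ?X0.
  - apply: eq_inj XM _ => i /=; apply: marker_agree => r rn.
    by rewrite X0'S.
  - by move=> i r rn; rewrite /= (hX0' i)// ?jn1// Y0.
  - apply: eq_inj YM _ => i /=; apply: marker_agree => r rn.
    by rewrite (hX0' i)// jn1.
have nE' : n = (j.+1 + d)%N by lia.
have [i r rj|g1 Gg1 g1X] := ih _ X X' nE' jn' (conj X0 XM) X'g.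
  by rewrite X'X0 ?X0'S//; lia.
have [i r rj|g2 Gg2 g2X] := ih _ (h \o X') Y nE' jn' hX'g (conj Y0 YM).
  by rewrite /= (hX0' i (X' i) (X'X0 i) r rj).
exists (g2 \o h \o g1); first by do !apply: (Gcomp) => //.
by move=> i /=; rewrite g1X g2X.
Qed.

Lemma transitive_of_generators : infinitely_transitive G.
Proof.
move=> m x y xinj yinj; have [Gid Gcomp Ginv] := hG.
have [g Gg gx] := make_good_tuple xinj; have [h Gh hy] := make_good_tuple yinj.
have [|f Gf fP] := good_tuple_transitive (leq0n n) gx hy.
  by move=> i r; rewrite leqn0; case: r.
have [h' [hK h'K]] := G_bij Gh; have Gh' := Ginv _ _ Gh hK h'K.
exists (h' \o f \o g); first by do !apply: (Gcomp) => //.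
by move=> i /=; rewrite fP /= hK.
Qed.
End Transitivity.

(** * Complex derivatives and the exponential *)

(* The topology of a numFieldType is found for a variable K, not for R[i]. *)
Definition has_deriv (K : numFieldType) (f : K -> K) (t df : K) : Prop :=
  is_derive t 1 f df.

Lemma has_derivP (K : numFieldType) (f : K -> K) (t df : K) :
  has_deriv f t df <->
  forall e, 0 < e -> exists2 d : K, 0 < d & forall h, h != 0 -> `|h| < d ->
    `|df - h^-1 * (f (h + t) - f t)| < e.
Proof.
pose q h := h^-1 *: ((f \o shift t) (h *: 1) - f t).
have qE h : q h = h^-1 * (f (h + t) - f t) by rewrite /q /= [h *: 1]mulr1.
have cvgP' : q @ 0^' --> df <->
    forall e, 0 < e -> exists2 d : K, 0 < d & forall h, h != 0 -> `|h| < d ->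
      `|df - h^-1 * (f (h + t) - f t)| < e.
  split=> [/cvgrPdist_lt qdf e e0|qdf].
    have /nbhs_ballP[d /= d0 dq] := qdf e e0; exists d => // h h0 hd.
    by rewrite -qE; apply: dq => //; rewrite -ball_normE /ball_/= sub0r normrN.
  apply/cvgrPdist_lt => e e0; have [d d0 dq] := qdf e e0.
  apply/nbhs_ballP; exists d => // h; rewrite -ball_normE /ball_/= sub0r normrN => hd h0.
  by rewrite qE dq.
rewrite -cvgP'; split=> [[fd <-]|qdf]; first exact: fd.
have qc : cvg (q @ 0^') by apply/cvg_ex; exists df.
by split=> //; exact: cvg_lim qdf.
Qed.

Lemma has_derivZ (K : numFieldType) (f : K -> K) (c t df : K) :
  has_deriv f t df -> has_deriv (fun x => c * f x) t (c * df).
Proof. by move=> fd; apply: (@is_deriveZ _ _ _ f c t 1 df). Qed.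

Section ComplexAnalysis.
Context (R : realType).
Local Notation C := R[i].
Local Notation Re := (@complex.Re R).
Local Notation Im := (@complex.Im R).

Lemma Re_le (z : C) : `|Re z|%:C%C <= `|z|.
Proof.
case: z => a b; rewrite normc_def /= lecR -sqrtr_sqr ler_wsqrtr//.
by rewrite lerDl sqr_ge0.
Qed.

Lemma Im_le (z : C) : `|Im z|%:C%C <= `|z|.
Proof.
case: z => a b; rewrite normc_def /= lecR -sqrtr_sqr ler_wsqrtr//.
by rewrite lerDr sqr_ge0.
Qed.

Lemma normC_real (x : R) : `|x%:C%C| = `|x|%:C%C.
Proof. by rewrite normc_def/= expr0n/= addr0 sqrtr_sqr. Qed.

Lemma gt0_real (d : C) : 0 < d -> exists2 r : R, 0 < r & d = r%:C%C.
Proof.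
by case: d => a b; rewrite ltcE/= => /andP[/eqP -> a0]; exists a.
Qed.

(** Restriction to a real line brings the real theorem on vanishing derivatives within reach. *)
Lemma is_derive_line (f : C -> C) (a b : C) : (forall t, has_deriv f t 0) ->
  forall s : R, has_deriv (fun s : R => Re (f (a + s%:C%C * b))) s 0.
Proof.
move=> fd s; have [->|b0] := eqVneq b 0.
  have -> : (fun s : R => Re (f (a + s%:C%C * 0))) = cst (Re (f a)).
    by apply/funext => x; rewrite mulr0 addr0.
  exact: is_derive_cst.
apply/has_derivP => e e0.
have nb : 0 < `|b| by rewrite normr_gt0.
have [be be0 bE] := gt0_real nb.
have ee : 0 < (e / be)%:C%C :> C by rewrite ltcR divr_gt0.
have /has_derivP/(_ _ ee)[d d0 dP] := fd (a + s%:C%C * b).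
have [r r0 dE] := gt0_real d0.
exists (r / be); first exact: divr_gt0.
move=> h h0 hr.
have hb0 : h%:C%C * b != 0 :> C by rewrite mulf_neq0// (inj_eq (@complexI _)).
have hbd : `|h%:C%C * b| < d.
  by rewrite normrM normC_real bE dE -rmorphM/= ltcR -ltr_pdivlMr.
have := dP _ hb0 hbd; rewrite sub0r normrN.
set F := f _ - f _ => FP.
have FE : f (a + (h + s)%:C%C * b) - f (a + s%:C%C * b) = F.
  by rewrite /F; congr (f _ - f _); rewrite rmorphD/=; ring.
rewrite sub0r normrN -raddfB FE.
have -> : h^-1 * Re F = Re (h^-1%:C%C * F).
  by case: (F) => x y; rewrite /= mul0r subr0.
rewrite -ltcR; apply: le_lt_trans (Re_le _) _.
have -> : h^-1%:C%C * F = b * ((h%:C%C * b)^-1 * F).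
  rewrite (fmorphV (real_complex R)); set k := real_complex R h.
  have k0 : k != 0 by rewrite (inj_eq (@complexI _)).
  by rewrite mulrA invfM mulrCA mulfV// mulr1.
have -> : e%:C%C = be%:C%C * (e / be)%:C%C :> C.
  by rewrite -rmorphM/= mulrC divfK ?gt_eqF.
by rewrite normrM bE ltr_pM2l // ltcR.
Qed.

Lemma zero_derivative_cst (f : C -> C) : (forall t, has_deriv f t 0) ->
  forall t, f t = f 0.
Proof.
have ReP (g : C -> C) : (forall t, has_deriv g t 0) ->
    forall t, Re (g t) = Re (g 0).
  move=> gd t; have := is_derive_0_is_cst 1 0 (is_derive_line 0 t gd).
  by rewrite !add0r mul1r mul0r.
move=> fd t; have R1 := ReP _ fd t.
(* The real part of i f is minus the imaginary part of f. *)
have id t' : has_deriv (fun x => 'i%C * f x) t' 0.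
  by have := has_derivZ 'i%C (fd t'); rewrite mulr0.
have I1 := ReP _ id t.
by move: R1 I1; case: (f t) (f 0) => x y [x' y']/= ->; rewrite !mul0r !mul1r !sub0r => /oppr_inj ->.
Qed.
End ComplexAnalysis.

(** * The complex exponential *)

Section ComplexExponential.
Context (R : realType).
Local Notation C := R[i].
Local Notation Re := (@complex.Re R).
Local Notation Im := (@complex.Im R).

Definition cexp (z : C) : C :=
  ((expR (Re z) * cos (Im z)) +i* (expR (Re z) * sin (Im z)))%C.

Lemma cexp0 : cexp 0 = 1.
Proof. by rewrite /cexp/= expR0 cos0 sin0 mulr1 mulr0. Qed.

Lemma cexpD (z w : C) : cexp (z + w) = cexp z * cexp w.
Proof.
case: z w => a b [c d]; rewrite /cexp /= expRD cosD sinD.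
by congr (_ +i* _)%C; ring.
Qed.

Lemma cexp_eq1 (z : C) : cexp z = 1 -> Re z = 0.
Proof.
case=> h1 h2; have : expR (Re z) ^+ 2 = 1.
  rewrite -[LHS]mulr1 -[X in _ * X = _](cos2Dsin2 (Im z)) mulrDr -!exprMn h1 h2.
  by rewrite expr1n expr0n addr0.
rewrite expr2 -expRD -[X in _ = X]expR0 => /expR_inj; lra.
Qed.

(** With c = p + i, the real part of c d is p Re d - Im d, which is nonzero for a generic natural p;
    the modulus of the exponential is then not 1. *)
Lemma cexp_separates (I : finType) (d : I -> C) : (forall i, d i != 0) ->
  exists c, forall i, cexp (c * d i) != 1.
Proof.
move=> d0.
have [i|p pP] := @common_nonroot R I (fun i => (- Im (d i))%:P + Re (d i) *: 'X).
  apply: linear_poly_neq0; rewrite oppr_eq0 -negb_and; apply: contra (d0 i).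
  by case: (d i) => a b /= /andP[/eqP-> /eqP->].
exists (p%:R +i* 1)%C => i; apply/eqP => /cexp_eq1.
have := pP i; rewrite hornerD hornerC hornerZ hornerX.
case: (d i) => a b /= /eqP + h; apply; rewrite -h; ring.
Qed.

Lemma normC_le (z : C) : `|z| <= (`|Re z| + `|Im z|)%:C%C.
Proof.
rewrite {1}[z]complexE (le_trans (ler_normD _ _))// rmorphD/= -!normC_real.
rewrite normrM (_ : `|'i%C| = 1) ?mul1r// normc_def/=.
by rewrite expr0n expr1n add0r sqrtr1.
Qed.

Lemma deriv0_small (f : R -> R) (df e : R) : has_deriv f 0 df -> 0 < e ->
  exists2 d : R, 0 < d & forall h, `|h| < d -> `|f h - f 0 - df * h| <= e * `|h|.
Proof.
move=> /has_derivP fd e0; have [d d0 dP] := fd e e0; exists d => // h hd.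
have [->|h0] := eqVneq h 0; first by rewrite subrr mulr0 subr0 normr0 mulr0.
have := dP h h0 hd; rewrite addr0 => /ltW.
rewrite -(ler_pM2r (_ : 0 < `|h|)) ?normr_gt0// -normrM mulrBl distrC.
by rewrite -mulrA mulrCA mulVf ?mulr1.
Qed.

(** First-order expansions of exp, cos and sin at 0 bound the real part by 2e|y| + e|x| and the
    imaginary part by 3e|y|, whence the constant 6. *)
Lemma cexp_small (e : R) : 0 < e -> exists2 d : R, 0 < d &
  forall h : C, `|h| < d%:C%C -> `|cexp h - 1 - h| <= (6 * e)%:C%C * `|h|.
Proof.
wlog e1 : e / e <= 1 => [H e0|e0].
  have [|/ltW e1] := leP e 1; first by move=> e1; exact: H.
  have [//|//|d d0 dP] := H 1; exists d => // h /dP /le_trans; apply.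
  by rewrite ler_wpM2r// lecR; lra.
have Ed : has_deriv (@expR R) 0 1 by rewrite -expR0; exact: is_derive_expR.
have Cd : has_deriv (@cos R) 0 0.
  by have := is_derive_cos (0 : R); rewrite sin0 oppr0.
have Sd : has_deriv (@sin R) 0 1 by rewrite -cos0; exact: is_derive_sin.
have [d1 d10 E1] := deriv0_small Ed e0.
have [d2 d20 C1] := deriv0_small Cd e0.
have [d3 d30 S1] := deriv0_small Sd e0.
(* The bound e / 2 on |x| gives |exp x - 1| <= (e + 1)|x| <= e, as e <= 1. *)
pose d := Num.min (Num.min d1 d2) (Num.min d3 (e / 2)).
have d0 : 0 < d by rewrite !lt_min d10 d20 d30 divr_gt0.
exists d => // -[x y] hd.
have xd : `|x| < d by rewrite -ltcR; apply: le_lt_trans (Re_le (x +i* y)%C) hd.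
have yd : `|y| < d by rewrite -ltcR; apply: le_lt_trans (Im_le (x +i* y)%C) hd.
have xh := Re_le (x +i* y)%C; have yh := Im_le (x +i* y)%C.
move: xd yd; rewrite !lt_min => /andP[/andP[x1 x2] /andP[x3 x4]].
move=> /andP[/andP[y1 y2] /andP[y3 y4]].
have := E1 _ x1; rewrite expR0 mul1r => {}E1.
have := C1 _ y2; rewrite cos0 mul0r subr0 => {}C1.
have := S1 _ y3; rewrite sin0 mul1r subr0 => {}S1.
have Ex : `|expR x - 1| <= e.
  rewrite -[expR x - 1](subrK x) (le_trans (ler_normD _ _))//.
  have : e * `|x| <= `|x| by rewrite ler_piMl.
  lra.
have Ex2 : `|expR x| <= 2.
  by rewrite -[expR x](subrK 1) (le_trans (ler_normD _ _))// normr1; lra.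
have h1 : `|expR x * (cos y - 1)| <= 2 * (e * `|y|).
  by rewrite normrM ler_pM.
have h2 : `|expR x * (sin y - y)| <= 2 * (e * `|y|).
  by rewrite normrM ler_pM.
have h3 : `|(expR x - 1) * y| <= e * `|y| by rewrite normrM ler_pM.
apply: le_trans (normC_le _) _; rewrite /cexp /=.
have hr : `|expR x * cos y - 1 - x| <= 2 * (e * `|y|) + e * `|x|.
  rewrite (_ : _ - x = expR x * (cos y - 1) + (expR x - 1 - x)); last ring.
  by rewrite (le_trans (ler_normD _ _))// lerD.
have hi : `|expR x * sin y - 0 - y| <= 2 * (e * `|y|) + e * `|y|.
  rewrite (_ : _ - y = expR x * (sin y - y) + (expR x - 1) * y); last ring.
  by rewrite (le_trans (ler_normD _ _))// lerD.
have : (`|expR x * cos y - 1 - x| + `|expR x * sin y - 0 - y|)%:C%C <=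
    (5 * e)%:C%C * `|y|%:C%C + e%:C%C * `|x|%:C%C :> C.
  by rewrite -!rmorphM -rmorphD/= lecR; lra.
move=> /le_trans; apply.
rewrite (_ : (6 * e)%:C%C = (5 * e)%:C%C + e%:C%C :> C); last first.
  by rewrite -rmorphD/=; congr (_ %:C)%C; ring.
by rewrite (mulrDl (5 * e)%:C%C) lerD// ler_wpM2l// lecR; lra.
Qed.

Lemma has_deriv_cexp (t : C) : has_deriv cexp t (cexp t).
Proof.
apply/has_derivP => e e0; have [r r0 ->] := gt0_real e0.
have [m m0 mE] : exists2 m : R, 0 <= m & `|cexp t| = m%:C%C.
  by rewrite normc_def; eexists; last reflexivity; exact: sqrtr_ge0.
(* Adding 1 makes 6 m r / (6 m + 1) < r hold for every m >= 0. *)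
have e'0 : 0 < r / (6 * m + 1) by rewrite divr_gt0//; lra.
have [d d0 dP] := cexp_small e'0.
exists d%:C%C; first by rewrite ltcR.
move=> h h0 hd; rewrite cexpD.
have -> : cexp t - h^-1 * (cexp h * cexp t - cexp t) =
    - (cexp t * (h^-1 * (cexp h - 1 - h))).
  by rewrite -{1}[cexp t]mulr1 -[X in _ * X - _](mulVf h0); ring.
rewrite normrN !normrM normfV mE.
have hn : 0 < `|h| by rewrite normr_gt0.
apply: (@le_lt_trans _ _ (m%:C%C * (6 * (r / (6 * m + 1)))%:C%C)).
  apply: ler_wpM2l; first by rewrite lecR.
  by rewrite mulrC ler_pdivrMr// dP.
rewrite -rmorphM/= ltcR (_ : m * _ = (6 * m * r) / (6 * m + 1)).
  by rewrite ltr_pdivrMr; [nra|lra].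
by rewrite !mulrA [m * 6]mulrC.
Qed.
End ComplexExponential.

(** * Flows of U, V and W *)

Section Derivatives.
Context (K : numFieldType).

Lemma is_derive_cvg (V W : normedModType K) (f : V -> W) (a v : V) (df : W) :
  is_derive a v f df <->
  (fun h => h^-1 *: ((f \o shift a) (h *: v) - f a)) @ 0^' --> df.
Proof.
split=> [[fd <-]|fdf]; first exact: fd.
by split; [apply/cvg_ex; exists df|exact: cvg_lim fdf].
Qed.

Lemma is_derive_rowP n (F : K -> 'rV[K]_n) (t : K) (dF : 'rV[K]_n) :
  is_derive t 1 F dF <-> forall j, has_deriv (fun s => F s 0 j) t (dF 0 j).
Proof.
split=> [/is_derive_cvg FdF j|Fj].
  apply/is_derive_cvg.
  have -> : (fun h => h^-1 *: (((fun s => F s 0 j) \o shift t) (h *: 1) - F t 0 j)) =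
      (fun M : 'rV[K]_n => M 0 j) \o
      (fun h => h^-1 *: ((F \o shift t) (h *: 1) - F t)).
    by apply/funext => h /=; rewrite !mxE.
  by apply: cvg_comp FdF _; exact: coord_continuous.
have -> : F = \sum_(j < n) (fun s => F s 0 j *: delta_mx 0 j).
  by apply/funext => s; rewrite fct_sumE -row_sum_delta.
rewrite [dF]row_sum_delta; apply: is_derive_sum => j; apply/is_derive_cvg.
have -> : (fun h => h^-1 *: (((fun s => F s 0 j *: delta_mx 0 j) \o shift t)
      (h *: 1) - F t 0 j *: delta_mx 0 j)) =
    fun h => (h^-1 *: (((fun s => F s 0 j) \o shift t) (h *: 1) - F t 0 j)) *:
      (delta_mx 0 j : 'rV[K]_n).
  by apply/funext => h /=; rewrite -scalerBl scalerA.
by apply: cvgZr_tmp; have /is_derive_cvg := Fj j.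
Qed.

Lemma has_deriv_cst (c t : K) : has_deriv (fun=> c) t 0.
Proof. exact: is_derive_cst. Qed.

Lemma has_deriv_id (t : K) : has_deriv (fun s => s) t 1.
Proof. exact: is_derive_id. Qed.

Lemma has_derivD (f g : K -> K) t df dg : has_deriv f t df ->
  has_deriv g t dg -> has_deriv (fun s => f s + g s) t (df + dg).
Proof. by move=> fd gd; apply: (@is_deriveD _ _ _ f g). Qed.

Lemma has_derivB (f g : K -> K) t df dg : has_deriv f t df ->
  has_deriv g t dg -> has_deriv (fun s => f s - g s) t (df - dg).
Proof. by move=> fd gd; apply: (@is_deriveB _ _ _ f g). Qed.

Lemma has_derivM (f g : K -> K) t df dg : has_deriv f t df ->
  has_deriv g t dg -> has_deriv (fun s => f s * g s) t (f t * dg + g t * df).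
Proof. by move=> fd gd; apply: (@is_deriveM _ _ f g). Qed.

Lemma has_deriv_horner (p : {poly K}) t :
  has_deriv (fun s => p.[s]) t p^`().[t].
Proof.
elim/poly_ind: p => [|p c ih].
  rewrite deriv0 horner0 (_ : (fun s => _) = fun=> 0); last first.
    by apply/funext => s; rewrite horner0.
  exact: has_deriv_cst.
rewrite (_ : (fun s => _) = fun s => p.[s] * s + c); last first.
  by apply/funext => s; rewrite hornerMXaddC.
have := has_derivD (has_derivM ih (has_deriv_id t)) (has_deriv_cst c t).
by rewrite derivMXaddC hornerD hornerM hornerX mulr1 addr0 [_ * t]mulrC.
Qed.

Lemma has_deriv_scale (f : K -> K) c t df : has_deriv f (c * t) df ->
  has_deriv (fun s => f (c * s)) t (c * df).
Proof.
have [->|c0] := eqVneq c 0.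
  rewrite !mul0r (_ : (fun s => _) = fun=> f 0); last first.
    by apply/funext => s; rewrite mul0r.
  by move=> _; exact: has_deriv_cst.
move=> /has_derivP fd; apply/has_derivP => e e0.
have c1 : 0 < `|c| by rewrite normr_gt0.
have [d d0 dP] := fd (e / `|c|) (divr_gt0 e0 c1).
exists (d / `|c|); first exact: divr_gt0.
move=> h h0 hd.
have -> : c * df - h^-1 * (f (c * (h + t)) - f (c * t)) =
    c * (df - (c * h)^-1 * (f (c * h + c * t) - f (c * t))).
  by rewrite [c * (h + t)]mulrDr [RHS]mulrBr invfM !mulrA mulfV// mul1r.
rewrite normrM mulrC -ltr_pdivlMr// dP ?mulf_neq0//.
by rewrite normrM mulrC -ltr_pdivlMr.
Qed.

Lemma has_deriv_shift (f : K -> K) c t df : has_deriv f (t + c) df ->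
  has_deriv (fun s => f (s + c)) t df.
Proof.
move=> /has_derivP fd; apply/has_derivP => e e0.
by have [d d0 dP] := fd e e0; exists d => // h h0 hd; rewrite -addrA dP.
Qed.

(** * Integral curves, and the fields in the coordinates x_r *)

Section Solutions.
Variable n : nat.
Local Notation Z := 'rV[K]_n.+1.
Local Notation crd := (@crd K n).

Definition solution (X : Z -> Z) (u : K -> Z) := forall t r, (r <= n)%N ->
  has_deriv (fun s => crd r (u s)) t (crd r (X (u t))).

Lemma solutionP (X : Z -> Z) (u : K -> Z) :
  (forall t : K, is_derive t 1 u (X (u t))) <-> solution X u.
Proof.
split=> [ud t r rn|ud t]; first by have /is_derive_rowP := ud t; exact.
apply/is_derive_rowP => j.
have := ud t (n - j)%N (leq_subr _ _).
by rewrite /crd subKn -1?ltnS// inord_val.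
Qed.

Definition unique_solutions (X : Z -> Z) := forall u v,
  solution X u -> solution X v -> u 0 = v 0 -> forall t, u t = v t.

(** The generating set allows every [phi] satisfying [is_flow]; uniqueness identifies it with an
    explicit formula. *)
Lemma flow_unique (X : Z -> Z) phi psi : unique_solutions X ->
  is_flow X phi -> is_flow X psi -> phi = psi.
Proof.
move=> Xu phiX psiX; apply/funext => t; apply/funext => z.
apply: (Xu (phi ^~ z) (psi ^~ z)).
- by apply/solutionP; case: (phiX z).
- by apply/solutionP; case: (psiX z).
- by rewrite (phiX z).1 (psiX z).1.
Qed.

Lemma flowD (X : Z -> Z) phi : unique_solutions X -> is_flow X phi ->
  forall s t z, phi (s + t) z = phi s (phi t z).
Proof.
move=> Xu phiX s t z.
apply: (Xu (fun s => phi (s + t) z) (phi ^~ (phi t z))).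
- move=> x r rn; have /solutionP/(_ (x + t) r rn) := (phiX z).2.
  exact: has_deriv_shift.
- by apply/solutionP; case: (phiX (phi t z)).
- by rewrite add0r (phiX _).1.
Qed.

Lemma flowK (X : Z -> Z) phi t : unique_solutions X -> is_flow X phi ->
  cancel (phi t) (phi (- t)).
Proof. by move=> Xu phiX z; rewrite -(flowD Xu phiX) addNr (phiX z).1. Qed.

Lemma flowNK (X : Z -> Z) phi t : unique_solutions X -> is_flow X phi ->
  cancel (phi (- t)) (phi t).
Proof. by move=> Xu phiX z; rewrite -(flowD Xu phiX) addrN (phiX z).1. Qed.

Lemma crd_fieldU r z : (r <= n)%N ->
  crd r (fieldU z) = if r == 0%N then 1 else 0.
Proof.
move=> rn; rewrite /crd /fieldU mxE eqxx /=.
have -> : (inord (n - r) == ord_max :> 'I_n.+1) = (r == 0%N).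
  by rewrite -val_eqE /= inordK ?ltnS ?leq_subr//; lia.
by case: (r == 0%N).
Qed.

(** Index reversal: s = n - j. *)
Lemma prod_crd (a b : nat) (z : Z) (F : K -> K) : (b <= n.+1)%N ->
  \prod_(j < n.+1 | (n.+1 - b <= j < n.+1 - a)%N) F (z 0 j) =
  \prod_(a <= s < b) F (crd s z).
Proof.
move=> bn; rewrite big_geq_mkord.
rewrite (big_ord_widen_cond n.+1 (fun i => (a <= i)%N) (fun i => F (crd i z)))//.
rewrite (reindex_inj rev_ord_inj); apply: eq_big => i /=.
  by have := ltn_ord i; lia.
move=> _; rewrite /crd; congr (F (z 0 _)); apply/val_inj => /=.
by rewrite inordK; have := ltn_ord i; lia.
Qed.

Lemma crd0_fieldV z : crd 0 (fieldV z) = 1.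
Proof.
rewrite /crd /fieldV mxE summxE -/(fieldU z) -/(crd 0 (fieldU z)) crd_fieldU//=.
rewrite big1 ?addr0// => k k0; rewrite !mxE eqxx/=.
rewrite (_ : _ == _ = false) ?mulr0//; apply/negbTE.
by rewrite -val_eqE /= !inordK; have := ltn_ord k; lia.
Qed.

Lemma crdS_fieldV r z : (r < n)%N ->
  crd r.+1 (fieldV z) = (\prod_(0 <= s < r) crd s z) * crd r z ^+ 3.
Proof.
move=> rn; rewrite /crd /fieldV mxE summxE -/(fieldU z).
rewrite -/(crd r.+1 (fieldU z)) crd_fieldU//= add0r.
(* The only summand directed along x_(r+1) is that of index n - r, the position of x_r. *)
have kn : (n - r < n.+1)%N by lia.
rewrite (bigD1 (Ordinal kn)) /=; last by lia.
rewrite [X in _ + X]big1 => [|k /andP[k0 kr]]; last first.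
  rewrite !mxE eqxx/= (_ : _ == _ = false) ?mulr0//; apply/negbTE.
  move: kr; rewrite -!val_eqE /= !inordK; have := ltn_ord k; lia.
rewrite addr0 !mxE !eqxx /= (_ : _ == _ = true) ?mulr1; last first.
  by rewrite -val_eqE /= !inordK; lia.
have rn1 : (r <= n.+1)%N by lia.
rewrite -(@prod_crd 0 r z id rn1) /crd; congr (_ * z 0 _ ^+ 3).
  by apply: eq_bigl => j; have := ltn_ord j; lia.
by apply/val_inj; rewrite /= inordK//; lia.
Qed.

Lemma crd_fieldW r z : (0 < n)%N -> (r <= n)%N ->
  crd r (fieldW z) = if r == 0%N then marker z * crd 0 z else 0.
Proof.
move=> n0 rn; rewrite /crd /fieldW mxE -/(fieldU z) -/(crd r (fieldU z)) crd_fieldU//.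
case: eqP => _; last by rewrite mulr0.
rewrite mulr1 /marker; congr (_ * _); last first.
  by congr (z 0 _); apply/val_inj; rewrite /= inordK ?subn0.
have n1 : (n.+1 <= n.+1)%N by [].
rewrite mulrC -big_nat_recr//= -prodrXl -(@prod_crd 1 n.+1 z (fun x => x ^+ 2) n1).
by apply: eq_bigl => j; lia.
Qed.
End Solutions.
End Derivatives.

(** * Primitives and Lagrange interpolation of polynomials *)

Section Primitive.
Context (K : numFieldType).

Definition primitive (p : {poly K}) : {poly K} :=
  \poly_(i < (size p).+1) (if i is j.+1 then p`_j / i%:R else 0).

Lemma coef_primitive p i : (primitive p)`_i = if i is j.+1 then p`_j / i%:R else 0.
Proof.
rewrite coef_poly; case: i => [|i] //; rewrite ltnS; case: ltnP => // ip.
by rewrite nth_default// mul0r.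
Qed.

Lemma deriv_primitive p : (primitive p)^`() = p.
Proof.
apply/polyP => i.
by rewrite coef_deriv coef_primitive -[LHS]mulr_natr divfK// pnatr_eq0.
Qed.

Lemma interpolation m (b w : 'I_m -> K) : injective b ->
  exists Q : {poly K}, forall i, Q.[b i] = w i.
Proof.
move=> binj.
pose L i : {poly K} := \prod_(j | j != i) ((b i - b j)^-1 *: ('X - (b j)%:P)).
exists (\sum_i w i *: L i) => k; rewrite horner_sum (bigD1 k)//= big1 => [|i ik].
  rewrite addr0 hornerZ /L horner_prod big1 ?mulr1// => j jk.
  rewrite !hornerE mulVf// subr_eq0; apply: contraNneq jk => /binj ->.
  by [].
rewrite hornerZ /L horner_prod (bigD1 k) 1?eq_sym//= hornerZ hornerXsubC subrr.
by rewrite !(mulr0, mul0r).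
Qed.
End Primitive.

(** * Explicit flows of U and V *)

Section CanonicalFlows.
Context (K : numFieldType) (n : nat).
Local Notation Z := 'rV[K]_n.+1.
Local Notation crd := (@crd K n).

Definition of_crd (f : nat -> K) : Z := \row_j f (n - j)%N.

Lemma crd_of_crd f r : (r <= n)%N -> crd r (of_crd f) = f r.
Proof.
by move=> rn; rewrite /crd mxE inordK ?ltnS ?leq_subr// subKn.
Qed.

(** The triangular system of V is integrated one coordinate at a time, as polynomials in time; the
    second component accumulates the product of the solutions of lower index. *)
Fixpoint flowV_polys (z : Z) (r : nat) : {poly K} * {poly K} :=
  if r is r'.+1 then
    let: (p, m) := flowV_polys z r' in
    ((crd r z)%:P + primitive (m * p ^+ 3), m * p)
  else ((crd 0 z)%:P + 'X, 1).

Definition flowV_poly z r := (flowV_polys z r).1.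

Lemma flowV_polysE z r : flowV_polys z r =
  (flowV_poly z r, \prod_(0 <= s < r) flowV_poly z s).
Proof.
elim: r => [|r ih]; first by rewrite /= big_geq.
by rewrite [LHS]surjective_pairing; congr pair; rewrite /= ih big_nat_recr.
Qed.

Lemma flowV_polyS z r : flowV_poly z r.+1 = (crd r.+1 z)%:P +
  primitive ((\prod_(0 <= s < r) flowV_poly z s) * flowV_poly z r ^+ 3).
Proof. by rewrite {1}/flowV_poly /= flowV_polysE. Qed.

Definition flowV (t : K) (z : Z) : Z := of_crd (fun r => (flowV_poly z r).[t]).
Definition flowU (t : K) (z : Z) : Z :=
  of_crd (fun r => if r == 0%N then crd 0 z + t else crd r z).

Lemma flowU_is_flow : is_flow (@fieldU K n) flowU.
Proof.
move=> z; split=> [|t].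
  by apply: crd_inj => -[|r] rn; rewrite crd_of_crd//= addr0.
move: t; apply/solutionP => t r rn; rewrite crd_fieldU//.
rewrite (_ : (fun s => _) = if r == 0%N then fun s => crd 0 z + s else fun=> crd r z).
  case: eqP => _; last exact: has_deriv_cst.
  by rewrite -[1]add0r; apply: has_derivD; [exact: has_deriv_cst|exact: has_deriv_id].
by apply/funext => s; rewrite crd_of_crd//; case: eqP.
Qed.

Lemma flowV_poly0 z r : (flowV_poly z r).[0] = crd r z.
Proof.
case: r => [|r]; first by rewrite /flowV_poly/= !hornerE.
by rewrite flowV_polyS hornerD hornerC !horner_coef0 coef_primitive addr0.
Qed.

Lemma flowV_is_flow : is_flow (@fieldV K n) flowV.
Proof.
move=> z; split=> [|t].
  by apply: crd_inj => r rn; rewrite crd_of_crd// flowV_poly0.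
move: t; apply/solutionP => t r rn.
rewrite (_ : (fun s => _) = fun s => (flowV_poly z r).[s]); last first.
  by apply/funext => s; rewrite crd_of_crd.
rewrite (_ : crd r _ = (flowV_poly z r)^`().[t]); first exact: has_deriv_horner.
case: r rn => [_|r rn].
  by rewrite crd0_fieldV /flowV_poly/= derivD derivC derivX add0r hornerC.
rewrite crdS_fieldV// flowV_polyS derivD derivC add0r deriv_primitive.
rewrite hornerM horner_exp horner_prod crd_of_crd; last by lia.
by congr (_ * _); apply: eq_big_nat => s sr; rewrite crd_of_crd//; lia.
Qed.

(** Time is given weight 1, opposite to the weight of V. *)
Definition pdeg (d : int) (p : Z -> {poly K}) :=
  forall i : nat, wdeg (d - i%:Z) (fun z => (p z)`_i).

Lemma wdeg_sum d (I : Type) (s : seq I) (F : I -> Z -> K) :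
  (forall i, wdeg d (F i)) -> wdeg d (fun z => \sum_(i <- s) F i z).
Proof.
move=> dF; elim: s => [|i s ih].
  by apply: (wdeg_ext (wdeg0 d)) => z; rewrite big_nil.
by apply: (wdeg_ext (wdegD (dF i) ih)) => z; rewrite big_cons.
Qed.

Lemma pdegM d d' p q : pdeg d p -> pdeg d' q -> pdeg (d + d') (fun z => p z * q z).
Proof.
move=> dp dq i.
have h : wdeg (d + d' - i%:Z) (fun z => \sum_(j < i.+1) (p z)`_j * (q z)`_(i - j)).
  apply: wdeg_sum => j; apply: (wdegW (wdegM (dp j) (dq (i - j)%N))).
  by have := ltn_ord j; lia.
by apply: (wdeg_ext h) => z; rewrite coefM.
Qed.

(** Integration in time raises the degree by 1, and (wo r - 1) + 3 wt r + 1 = wt (r+1). *)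
Lemma pdeg_flowV r : (r <= n)%N -> pdeg (wt r) (fun z => flowV_poly z r) /\
  pdeg ((wo r)%:Z - 1) (fun z => \prod_(0 <= s < r) flowV_poly z s).
Proof.
elim: r => [_|r ih rn].
  split=> i.
    have h : wdeg ((wt 0)%:Z - i%:Z)
        (fun z => if i is j.+1 then (if j is 0 then 1 else 0) else crd 0 z).
      case: i => [|[|i]]; [|exact: wdegC|exact: wdeg0].
      by apply: wdeg_crd; lia.
    apply: (wdeg_ext h) => z; rewrite /flowV_poly/= coefD coefC coefX.
    by case: i {h} => [|[|i]]/=; rewrite ?addr0 ?add0r.
  have h : wdeg ((wo 0)%:Z - 1 - i%:Z) (fun z : Z => if i is 0 then 1 else 0 : K).
    by case: i => [|i]; [exact: wdegC|exact: wdeg0].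
  apply: (wdeg_ext h) => z; rewrite big_geq// coef1.
  by case: i {h}.
have [pr mr] := ih (ltnW rn); split; last first.
  rewrite woS (_ : _ - 1 = (wo r)%:Z - 1 + (wt r)%:Z); last lia.
  rewrite (_ : (fun z => _) =
    fun z => (\prod_(0 <= s < r) flowV_poly z s) * flowV_poly z r).
    exact: pdegM.
  by apply/funext => z; rewrite big_nat_recr.
have := pdegM mr (pdegM pr (pdegM pr pr)) => mp.
case=> [|i].
  have h := wdeg_crd (K := K) rn (lexx (wt r.+1)%:Z).
  rewrite subr0; apply: (wdeg_ext h) => z.
  by rewrite flowV_polyS coefD coefC coef_primitive addr0.
rewrite wtS; have h := wdegW (wdegZ (i.+1%:R^-1) (mp i)) _.
apply: (wdeg_ext (h ((wo r + 3 * wt r)%:Z - i.+1%:Z) _)) => [|z]; first by lia.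
by rewrite flowV_polyS coefD coefC coef_primitive/= add0r mulrC !exprS expr0 mulr1.
Qed.

Lemma size_flowV z r : (r <= n)%N -> (size (flowV_poly z r) <= (wt r).+1)%N.
Proof.
move=> rn; apply/leq_sizeP => j rj; have [h _] := pdeg_flowV rn.
by apply: (wdeg_neg (h j)); lia.
Qed.

Lemma crd_flowV t z r : (r <= n)%N ->
  crd r (flowV t z) = \sum_(i < (wt r).+1) (flowV_poly z r)`_i * t ^+ i.
Proof.
by move=> rn; rewrite crd_of_crd// (horner_coef_wide _ (size_flowV z rn)).
Qed.

Lemma flowV_coef1 z r : (r <= n)%N -> (flowV_poly z r)`_1 = leadV 0 r z.
Proof.
case: r => [_|r rn]; first by rewrite /flowV_poly/= coefD coefC coefX add0r.
rewrite flowV_polyS coefD coefC coef_primitive add0r divr1 /leadV/=.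
rewrite -horner_coef0 hornerM horner_exp horner_prod flowV_poly0.
by congr (_ * _); apply: eq_bigr => s _; rewrite flowV_poly0.
Qed.

(** In powers of time, the flow of x_r starts with x_r and the component of V; the coefficients from
    the square on have degree at most [wt r - 2]. *)
Lemma leading_flowV : leading 1 (fun l => @leadV K n 0 l) (flowV 1).
Proof.
have tail r i0 d : (r <= n)%N -> (wt r)%:Z - i0%:Z <= d -> wdeg d
    (fun z => \sum_(i < (wt r).+1 | (i0 <= i)%N) (flowV_poly z r)`_i).
  move=> rn rd.
  have h : wdeg d (fun z => \sum_(i < (wt r).+1)
      if (i0 <= i)%N then (flowV_poly z r)`_i else 0).
    apply: wdeg_sum => i; case: leqP => i0i; last exact: wdeg0.
    by have [h _] := pdeg_flowV rn; apply: (wdegW (h i)); lia.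
  by apply: (wdeg_ext h) => z; rewrite -big_mkcond.
have flowE z r : (r <= n)%N -> crd r (flowV 1 z) = crd r z +
    \sum_(i < (wt r).+1 | (1 <= i)%N) (flowV_poly z r)`_i.
  move=> rn; rewrite crd_flowV// (bigD1 ord0)//= -horner_coef0 flowV_poly0 mulr1.
  congr (_ + _); apply: eq_big => [i|i _]; last by rewrite expr1n mulr1.
  by rewrite -val_eqE/= lt0n.
split.
  apply: lowers_crd => // r rn; apply: (wdeg_ext (tail r 1%N _ rn (lexx _))) => z.
  by rewrite flowE//; ring.
move=> r rn.
have d2 : (wt r)%:Z - 2%:Z <= (wt r)%:Z - 1 - 1 by lia.
apply: (wdeg_ext (tail r 2%N _ rn d2)) => z; rewrite flowE//.
have w1 : (1 < (wt r).+1)%N by have := wt_gt0 r; lia.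
rewrite [in RHS](bigD1 (Ordinal w1))//= flowV_coef1//.
rewrite (_ : _ + _ - _ - _ = \sum_(i < (wt r).+1 | (0 < i)%N && (i != Ordinal w1))
  (flowV_poly z r)`_i); last by ring.
by apply: eq_bigl => i; rewrite -val_eqE/=; lia.
Qed.

Lemma leading_flowU : leading 1 (fun l (_ : Z) => if l == 0%N then 1 else 0) (flowU 1).
Proof.
have E r z : (r <= n)%N -> crd r (flowU 1 z) - crd r z = if r == 0%N then 1 else 0.
  by move=> rn; rewrite crd_of_crd//; case: eqP => [->|_]; ring.
split.
  apply: lowers_crd => // r rn.
  apply: (@wdeg_ext _ _ _ (fun=> if r == 0%N then 1 else 0)) => [|z].
    by case: eqP => [->|_]; [exact: wdegC|exact: wdeg0].
  by rewrite E.
by move=> r rn; apply: (wdeg_ext (wdeg0 _)) => z; rewrite E ?subrr.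
Qed.

Lemma differentiable_of_crd (f : Z -> Z) z :
  (forall r, (r <= n)%N -> differentiable (fun z => crd r (f z)) z) ->
  differentiable f z.
Proof.
move=> fd.
have -> : f = \sum_(j < n.+1) (fun z => f z 0 j *: delta_mx 0 j).
  by apply/funext => s; rewrite fct_sumE -row_sum_delta.
apply: differentiable_sum => j; apply: differentiableZl.
have := fd (n - j)%N (leq_subr _ _); rewrite /crd subKn -1?ltnS//.
by rewrite inord_val.
Qed.

Lemma differentiable_crd r z : differentiable (crd r) z.
Proof. exact: differentiable_coord. Qed.

Lemma differentiable_wdeg d (f : Z -> K) z : wdeg d f -> differentiable f z.
Proof.
elim=> {d f} [d|d c _|d r f _ _ ih|d f g _ ihf _ ihg].
- exact: differentiable_cst.
- exact: differentiable_cst.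
- exact: (differentiableM (differentiable_crd r z) ih).
- exact: (differentiableD ihf ihg).
Qed.

Lemma flowV_holomorphic t : holomorphic (flowV t).
Proof.
move=> z; apply: differentiable_of_crd => r rn.
apply: (@differentiable_wdeg (wt r)).
have h : wdeg (wt r) (fun z => \sum_(i < (wt r).+1) (flowV_poly z r)`_i * t ^+ i).
  apply: wdeg_sum => i; have [h _] := pdeg_flowV rn.
  by apply: (wdeg_ext (wdegZ (t ^+ i) (wdegW (h i) _))) => [|y]; [lia|exact: mulrC].
by apply: (wdeg_ext h) => y; rewrite crd_flowV.
Qed.

Lemma flowU_holomorphic t : holomorphic (flowU t).
Proof.
move=> z; apply: differentiable_of_crd => r rn.
have -> : (fun z => crd r (flowU t z)) =
    if r == 0%N then fun z => crd 0 z + t else crd r.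
  by apply/funext => y; rewrite crd_of_crd//; case: eqP.
case: eqP => _; last exact: differentiable_crd.
exact: (differentiableD (differentiable_crd 0 z) (differentiable_cst t z)).
Qed.
End CanonicalFlows.

(** * The flow of W and the group generated by the three flows *)

Section FlowGroup.
Context (K : numFieldType) (n : nat).
Local Notation Z := 'rV[K]_n.+1.
Local Notation crd := (@crd K n).
Local Notation fields := [set @fieldU K n; @fieldV K n; @fieldW K n].
Hypothesis n_gt0 : (0 < n)%N.
(** The facts special to the complex numbers enter through these hypotheses; [e] stands for the
    exponential. *)
Hypothesis zero_deriv_cst : forall f : K -> K,
  (forall t, has_deriv f t 0) -> forall t, f t = f 0.
Variable e : K -> K.
Hypothesis e0 : e 0 = 1.
Hypothesis eD : forall s t, e (s + t) = e s * e t.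
Hypothesis e_deriv : forall t, has_deriv e t (e t).
Hypothesis e_separates : forall (I : finType) (d : I -> K),
  (forall i, d i != 0) -> exists c, forall i, e (c * d i) != 1.

Lemma eq_of_deriv (f g d : K -> K) : (forall t, has_deriv f t (d t)) ->
  (forall t, has_deriv g t (d t)) -> f 0 = g 0 -> f =1 g.
Proof.
move=> fd gd fg0 t; apply/eqP; rewrite -subr_eq0; apply/eqP.
rewrite (@zero_deriv_cst (fun t => f t - g t)) ?fg0 ?subrr// => s.
by have := has_derivB (fd s) (gd s); rewrite subrr.
Qed.

Lemma has_deriv_exp c t : has_deriv (fun s => e (s * c)) t (c * e (t * c)).
Proof.
rewrite (_ : (fun s => _) = fun s => e (c * s)).
  by rewrite [t * c]mulrC; apply/has_deriv_scale/e_deriv.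
by apply/funext => s; rewrite mulrC.
Qed.

(** The product f(t) e(-tc) has derivative zero. *)
Lemma exp_ode (f : K -> K) c : (forall t, has_deriv f t (c * f t)) ->
  forall t, f t = f 0 * e (t * c).
Proof.
move=> fd t; have := @zero_deriv_cst (fun t => f t * e (t * - c)).
move=> /(_ _ t); rewrite mul0r e0 mulr1 => <- => [|s].
  by rewrite -mulrA -eD mulrN addNr e0 mulr1.
have := has_derivM (fd s) (has_deriv_exp (- c) s).
by rewrite (_ : _ + _ = 0)//; ring.
Qed.

Lemma unique_fieldU : unique_solutions (@fieldU K n).
Proof.
move=> u v hu hv uv0 t; apply: crd_inj => r rn.
apply: (@eq_of_deriv (crd r \o u) (crd r \o v)
  (fun=> if r == 0%N then 1 else 0)) => [s|s|]; last by rewrite /= uv0.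
- by have := hu s r rn; rewrite crd_fieldU.
- by have := hv s r rn; rewrite crd_fieldU.
Qed.

(** Each component of V depends on lower coordinates only, so by induction two solutions have equal
    derivatives. *)
Lemma unique_fieldV : unique_solutions (@fieldV K n).
Proof.
move=> u v hu hv uv0 t; apply: crd_inj => r; move: r t; elim/ltn_ind => r ih t rn.
apply: (@eq_of_deriv (crd r \o u) (crd r \o v)
  (fun t => crd r (fieldV (u t)))) => [s|s|]; last by rewrite /= uv0.
  exact: hu.
rewrite (_ : crd r _ = crd r (fieldV (v s))); first exact: hv.
case: r ih rn => [|r] ih rn; first by rewrite !crd0_fieldV.
rewrite !crdS_fieldV// ih//; last by lia.
by congr (_ * _); apply: eq_big_nat => i ir; rewrite ih//; lia.
Qed.

Definition flowW (t : K) (z : Z) : Z := set_crd z 0 (crd 0 z * e (t * marker z)).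

(** Along W the coordinates x_1, ..., x_n are constant, hence so is the marker, and x_0 satisfies a
    linear equation with constant coefficient. *)
Lemma solution_fieldW u : solution (@fieldW K n) u ->
  forall t, u t = flowW t (u 0).
Proof.
move=> hu t.
have uS s r : (0 < r <= n)%N -> crd r (u s) = crd r (u 0).
  move=> /andP[r0 rn]; apply: (@zero_deriv_cst (crd r \o u)) => x.
  by have := hu x r rn; rewrite crd_fieldW// gtn_eqF.
have um s : marker (u s) = marker (u 0).
  by apply: (marker_agree n_gt0) => // r; exact: uS.
apply: crd_inj => -[|r] rn; rewrite crd_set_crd//=; last exact: uS.
apply: (@exp_ode (crd 0 \o u)) => s.
by have := hu s 0%N rn; rewrite crd_fieldW//= um.
Qed.

Lemma unique_fieldW : unique_solutions (@fieldW K n).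
Proof.
by move=> u v hu hv uv0 t; rewrite (solution_fieldW hu) (solution_fieldW hv) uv0.
Qed.

Lemma crd0_flowW t z : crd 0 (flowW t z) = crd 0 z * e (t * marker z).
Proof. by rewrite crd_set_crd. Qed.

Lemma crdS_flowW t z r : (0 < r <= n)%N -> crd r (flowW t z) = crd r z.
Proof. by move=> /andP[r0 rn]; rewrite crd_set_crd// gtn_eqF. Qed.

Lemma marker_flowW t z : marker (flowW t z) = marker z.
Proof. by apply: (marker_agree n_gt0) => // r; exact: crdS_flowW. Qed.

Lemma flowW_is_flow : is_flow (@fieldW K n) flowW.
Proof.
move=> z; split=> [|t].
  apply: crd_inj => -[|r] rn; last by rewrite crdS_flowW.
  by rewrite crd0_flowW mul0r e0 mulr1.
move: t; apply/solutionP => t r rn; rewrite crd_fieldW//.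
case: r rn => [|r] rn /=.
  rewrite (_ : (fun s => _) = fun s => crd 0 z * e (s * marker z)); last first.
    by apply/funext => s; rewrite crd0_flowW.
  rewrite crd0_flowW marker_flowW mulrCA.
  by apply: has_derivZ; exact: has_deriv_exp.
rewrite (_ : (fun s => _) = fun=> crd r.+1 z); first exact: has_deriv_cst.
by apply/funext => s; rewrite crdS_flowW.
Qed.

Lemma differentiable_marker z : differentiable (@marker K n) z.
Proof.
have hc : differentiable (@cofactor_W K n) z.
  rewrite /cofactor_W; elim: (index_iota 1 n) => [|r s ih].
    rewrite (_ : (fun z => _) = cst 1); first exact: differentiable_cst.
    by apply/funext => y; rewrite big_nil.
  rewrite (_ : (fun z => _) = crd r * (fun z => \prod_(i <- s) crd i z)).
    exact: (differentiableM (differentiable_crd r z) ih).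
  by apply/funext => y; rewrite big_cons.
have hd := differentiableM (differentiable_crd n z) hc.
exact: (differentiableM hd hd).
Qed.

Lemma flowW_holomorphic t : holomorphic (flowW t).
Proof.
move=> z; apply: differentiable_of_crd => -[|r] rn; last first.
  rewrite (_ : (fun z => _) = crd r.+1); first exact: differentiable_crd.
  by apply/funext => y; rewrite crdS_flowW.
rewrite (_ : (fun z => _) = crd 0 * (e \o (fun z => t *: marker z))); last first.
  by apply/funext => y; rewrite crd0_flowW.
apply: (differentiableM (differentiable_crd 0 z)).
apply: differentiable_comp; first exact/differentiableZ/differentiable_marker.
apply/derivable1_diffP; apply: ex_derive; exact: e_deriv.
Qed.

Lemma fields_flow X phi : fields X -> is_flow X phi ->
  unique_solutions X /\ forall t, holomorphic (phi t).
Proof.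
move=> [[]|] -> phiX.
- split; first exact: unique_fieldU.
  rewrite (flow_unique unique_fieldU phiX (@flowU_is_flow K n)).
  exact: flowU_holomorphic.
- split; first exact: unique_fieldV.
  rewrite (flow_unique unique_fieldV phiX (@flowV_is_flow K n)).
  exact: flowV_holomorphic.
- split; first exact: unique_fieldW.
  rewrite (flow_unique unique_fieldW phiX flowW_is_flow).
  exact: flowW_holomorphic.
Qed.

Lemma map_group_hol_aut : map_group (@hol_aut K n.+1).
Proof.
split.
- have idh : @holomorphic K n.+1 id.
    by move=> z; apply: differentiable_of_crd => r _; exact: differentiable_crd.
  by split=> //; exists id; split.
- move=> f g [fh [f' [f'h fK f'K]]] [gh [g' [g'h gK g'K]]]; split=> [z|].
    by apply: differentiable_comp; [exact: gh|exact: fh].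
  exists (g' \o f'); split=> [z|z|z] /=.
  + by apply: differentiable_comp; [exact: f'h|exact: g'h].
  + by rewrite fK gK.
  + by rewrite g'K f'K.
- move=> f g [fh [f' [f'h fK f'K]]] fg gf.
  have -> : g = f' by apply/funext => z; rewrite -{1}[z]f'K fg.
  by split=> //; exists f.
Qed.

Lemma flow_group_hol_aut : flow_group fields `<=` @hol_aut K n.+1.
Proof.
apply: smallest_sub; first exact: map_group_hol_aut.
move=> _ [X [phi [t [FX phiX ->]]]]; have [Xu phih] := fields_flow FX phiX.
split; first exact: phih.
by exists (phi (- t)); split; [exact: phih|exact: (flowK t Xu phiX)|exact: (flowNK t Xu phiX)].
Qed.

Lemma map_group_flow_group : map_group (flow_group fields).
Proof.
split.
- by move=> M [[]].
- by move=> f g Gf Gg M MP; have [[_ Mc _] _] := MP; apply: Mc; [exact: Gf|exact: Gg].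
- move=> f g Gf fg gf M MP; have [[_ _ Mi] _] := MP.
  by apply: Mi fg gf; exact: Gf.
Qed.

Lemma flow_group_time X phi t : fields X -> is_flow X phi ->
  flow_group fields (phi t).
Proof. by move=> FX phiX M [_]; apply; exists X, phi, t. Qed.

Let GU t : flow_group fields (@flowU K n t).
Proof. by apply: flow_group_time (@flowU_is_flow K n); left; left. Qed.

Let GV t : flow_group fields (@flowV K n t).
Proof. by apply: flow_group_time (@flowV_is_flow K n); left; right. Qed.

Let GW t : flow_group fields (flowW t).
Proof. by apply: flow_group_time flowW_is_flow; right. Qed.

(** Conjugating the translation of x_0 by the flow of W gives (x_0 e(-cM) + a) e(cM), with M the
    marker. *)
Lemma exp_shear (a c : K) : exists2 g, flow_group fields g & forall z,
  crd 0 (g z) = crd 0 z + a * e (c * marker z) /\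
  forall r, (0 < r <= n)%N -> crd r (g z) = crd r z.
Proof.
have [_ Gcomp _] := map_group_flow_group.
exists (flowW c \o @flowU K n a \o flowW (- c)).
  by do !apply: (Gcomp) => //.
move=> z /=.
have US (y : Z) r : (0 < r <= n)%N -> crd r (flowU a y) = crd r y.
  by move=> /andP[r0 rn]; rewrite crd_of_crd// gtn_eqF.
have mU (y : Z) : marker (flowU a y) = marker y by apply: (marker_agree n_gt0) => r; exact: US.
split=> [|r rn]; last by rewrite crdS_flowW// US// crdS_flowW.
rewrite crd0_flowW mU marker_flowW crd_of_crd//= crd0_flowW mulrDl -mulrA -eD.
by rewrite mulNr addNr e0 mulr1.
Qed.

Lemma exp_poly_shear (q : nat -> K) c m : exists2 g, flow_group fields g &
  forall z, crd 0 (g z) = crd 0 z + \sum_(k < m) q k * e (c * marker z) ^+ k /\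
  forall r, (0 < r <= n)%N -> crd r (g z) = crd r z.
Proof.
have [Gid Gcomp _] := map_group_flow_group.
elim: m => [|m [g Gg gP]].
  by exists id => // z; rewrite big_ord0 addr0.
have [h Gh hP] := exp_shear (q m) (m%:R * c).
have eX x k : e (k%:R * x) = e x ^+ k.
  elim: k => [|k ih]; first by rewrite mul0r e0.
  by rewrite -natr1 mulrDl mul1r eD ih exprSr.
exists (h \o g) => [|z /=]; first exact: Gcomp.
have [h1 h2] := hP (g z); have [g1 g2] := gP z.
have mg : marker (g z) = marker z by apply: (marker_agree n_gt0).
split=> [|r rn]; last by rewrite h2// g2.
by rewrite h1 g1 mg big_ord_recr/= -mulrA eX addrA.
Qed.

(** For a suitable c the values e(cM) at the points are distinct, and a polynomial in e(cM)
    interpolates the required increments of x_0. *)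
Lemma flow_group_marker m (X : 'I_m -> Z) (v : 'I_m -> K) :
  injective (@marker K n \o X) -> exists2 g, flow_group fields g & forall i,
    crd 0 (g (X i)) = v i /\
    forall s, (0 < s <= n)%N -> crd s (g (X i)) = crd s (X i).
Proof.
move=> Xinj; pose M i := marker (X i).
have [[i j]|c cP] := @e_separates ('I_m * 'I_m)%type
    (* The diagonal value 1 only serves to meet the nonvanishing condition. *)
    (fun ij => if ij.1 == ij.2 then 1 else M ij.1 - M ij.2).
  case: ifPn => [_|ij]; first exact: oner_neq0.
  by rewrite subr_eq0; apply: contraNneq ij => /Xinj ->.
have binj : injective (fun i => e (c * M i)).
  move=> i j eij; apply/eqP; apply: contraT => ij.
  have := cP (i, j); rewrite /= (negbTE ij) mulrBr => /eqP; case.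
  by rewrite eD eij -eD addrN e0.
have [Q QP] := interpolation (fun i => v i - crd 0 (X i)) binj.
have [g Gg gP] := exp_poly_shear (fun k => Q`_k) c (size Q).
exists g => // i; have [g0 gS] := gP (X i); split=> //.
by rewrite g0 -horner_coef QP addrC subrK.
Qed.

Lemma flow_group_elt X phi a : fields X -> is_flow X phi -> leading 1 a (phi 1) ->
  elt (flow_group fields) 1 a (phi 1).
Proof.
move=> FX phiX phia; have [Xu _] := fields_flow FX phiX.
split=> //; first exact: flow_group_time phiX.
by exists (phi (- 1)); split=> //; [exact: (flowK 1 Xu phiX)|exact: (flowNK 1 Xu phiX)].
Qed.

Lemma flow_group_transitive : infinitely_transitive (flow_group fields).
Proof.
have hG := map_group_flow_group.
have Vlead : elt (flow_group fields) 1 (fun l => @leadV K n 0 l) (flowV 1).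
  apply: (@flow_group_elt (@fieldV K n) (@flowV K n)).
  - by left; right.
  - exact: flowV_is_flow.
  - exact: leading_flowV.
have Ulead : elt (flow_group fields) 1
    (fun l (_ : Z) => if l == 0%N then 1 else 0) (flowU 1).
  apply: (@flow_group_elt (@fieldU K n) (@flowU K n)).
  - by left; left.
  - exact: flowU_is_flow.
  - exact: leading_flowU.
apply: transitive_of_generators => //.
- by move=> g /flow_group_hol_aut[_ [g' [_ gK g'K]]]; exists g'.
- exact: (translation hG Vlead Ulead).
- exact: (mover_exists hG Vlead Ulead).
- exact: flow_group_marker.
Qed.

Lemma flow_group_main :
  [/\ complete (@fieldU K n), complete (@fieldV K n), complete (@fieldW K n),
      flow_group fields `<=` @hol_aut K n.+1 &
      infinitely_transitive (flow_group fields)].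
Proof.
split.
- by exists (@flowU K n); exact: flowU_is_flow.
- by exists (@flowV K n); exact: flowV_is_flow.
- by exists flowW; exact: flowW_is_flow.
- exact: flow_group_hol_aut.
- exact: flow_group_transitive.
Qed.
End FlowGroup.

Theorem corollary8 (R : realType) (n : nat) (hn : (2 <= n.+1)%N) :
  [/\ complete (@fieldU R[i] n), complete (@fieldV R[i] n),
      complete (@fieldW R[i] n),
      flow_group [set @fieldU R[i] n; @fieldV R[i] n; @fieldW R[i] n]
        `<=` @hol_aut R[i] n.+1 &
      infinitely_transitive
        (flow_group [set @fieldU R[i] n; @fieldV R[i] n; @fieldW R[i] n])].
Proof.
apply: (@flow_group_main _ _ hn _ (@cexp R)).
- exact: zero_derivative_cst.
- exact: cexp0.
- exact: cexpD.
- exact: has_deriv_cexp.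
- exact: cexp_separates.
Qed.
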